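(* Let $\mathcal{H}_S$ and $\mathcal{H}_E$ be finite-dimensional Hilbert spaces with $d_S=\dim\mathcal{H}_S$, and let $\mathcal{S}$ be a nonempty set of density operators on $\mathcal{H}_S\otimes\mathcal{H}_E$. Let $\mathcal{S}'=\{\rho_{SE}^{(1)},\dots,\rho_{SE}^{(m)}\}\subseteq\mathcal{S}$ be a maximal linearly independent subset of $\mathcal{S}$, and assume that the reduced states $\rho_S^{(i)}=\mathrm{Tr}_E(\rho_{SE}^{(i)})$, $i=1,\dots,m$, are also linearly independent (so $m\le d_S^2$). Put $\mathcal{V}=\mathrm{Span}_{\mathbb{C}}\mathcal{S}$ and $\mathcal{V}_S=\mathrm{Tr}_E\mathcal{V}=\mathrm{Span}_{\mathbb{C}}\{\rho_S^{(1)},\dots,\rho_S^{(m)}\}$. Define the reference state $$\omega_{RSE}=\sum_{l=1}^m\frac1m\,|l_R\rangle\langle l_R|\otimes\rho_{SE}^{(l)}\in\mathcal{D}(\mathcal{H}_R\otimes\mathcal{H}_S\otimes\mathcal{H}_E),$$ where $\{|l_R\rangle\}_{l=1}^m$ is an orthonormal basis of an auxiliary Hilbert space $\mathcal{H}_R$. Suppose there exists a linear, trace-preserving, positive map $\Lambda_S^{(P)}:\mathcal{L}(\mathcal{H}_S)\to\mathcal{L}(\mathcal{H}_S\otimes\mathcal{H}_E)$ that maps $\mathcal{V}_S$ to $\mathcal{V}$, i.e. $\Lambda_S^{(P)}(\rho_S^{(i)})=\rho_{SE}^{(i)}$ for $i=1,\dots,m$ (equivalently $\Lambda_S^{(P)}(\mathrm{Tr}_E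 X)=X$ for all $X\in\mathcal{V}$). Then: (i) $\omega_{RSE}$ is a Markov state; (ii) there exists a linear, trace-preserving, completely positive map $\Lambda_S^{(CP)}:\mathcal{L}(\mathcal{H}_S)\to\mathcal{L}(\mathcal{H}_S\otimes\mathcal{H}_E)$ with $\Lambda_S^{(CP)}(\rho_S^{(i)})=\rho_{SE}^{(i)}$ for all $i=1,\dots,m$; (iii) $\mathrm{Tr}_E(\mathcal{D}(\mathcal{H}_S\otimes\mathcal{H}_E)\cap\mathcal{V})=\mathcal{D}(\mathcal{H}_S)\cap\mathcal{V}_S$, and for every unitary $U$ on $\mathcal{H}_S\otimes\mathcal{H}_E$ the map $\mathcal{E}_S=\mathrm{Tr}_E\circ\mathrm{Ad}_U\circ\Lambda_S^{(CP)}$ (where $\mathrm{Ad}_U(X)=UXU^\dagger$) is completely positive and satisfies $\mathcal{E}_S(\mathrm{Tr}_E\rho_{SE})=\mathrm{Tr}_E(U\rho_{SE}U^\dagger)$ for every $\rho_{SE}\in\mathcal{D}(\mathcal{H}_S\otimes\mathcal{H}_E)\cap\mathcal{V}$.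
   Context: $\mathcal{L}(\mathcal{H})$ denotes the linear operators on $\mathcal{H}$ and $\mathcal{D}(\mathcal{H})$ the density operators. A positive map sends positive semidefinite operators to positive semidefinite operators; completely positive means $\mathrm{id}_k\otimes\Phi$ is positive for all $k$. A tripartite state $\sigma_{RSE}\in\mathcal{D}(\mathcal{H}_R\otimes\mathcal{H}_S\otimes\mathcal{H}_E)$ is a Markov state if there is a decomposition $\mathcal{H}_S=\bigoplus_k\mathcal{H}_{s_k^L}\otimes\mathcal{H}_{s_k^R}$ (orthogonal direct sum) such that $\sigma_{RSE}=\bigoplus_k\lambda_k\,\sigma_{Rs_k^L}\otimes\sigma_{s_k^RE}$ with $\{\lambda_k\}$ a probability distribution, $\sigma_{Rs_k^L}\in\mathcal{D}(\mathcal{H}_R\otimes\mathcal{H}_{s_k^L})$ and $\sigma_{s_k^RE}\in\mathcal{D}(\mathcal{H}_{s_k^R}\otimes\mathcal{H}_E)$. *)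

(* Defs.v *)
(* Scalars: complex numbers  C := R[i]  over a real field
   R : realType (R = the reals gives the usual complex field).
   Finite-dimensional Hilbert spaces are C^d; operators are d x d matrices;
   tensor products are Kronecker products with the standard index ordering
   (i, j) |-> i * n + j  (mxtens_index from mathcomp real_closed/mxtens). *)
From HB Require Import structures.
From mathcomp Require Import all_boot all_order all_algebra.
From mathcomp Require Import complex mxtens.
From mathcomp Require Import reals.
Set Implicit Arguments.
Unset Strict Implicit.
Unset Printing Implicit Defensive.
Import Order.TTheory GRing.Theory Num.Theory.
Local Open Scope ring_scope.

Section QDefs.
Variable R : realType.
Local Notation C := (R[i]).

Definition adj (p q : nat) (A : 'M[C]_(p, q)) : 'M[C]_(q, p) :=
  map_mx (@conjc R) A^T.

Definition psd (n : nat) (A : 'M[C]_n) : Prop :=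
  forall v : 'cV[C]_n, 0 <= (adj v *m A *m v) 0 0.

Definition density (n : nat) (A : 'M[C]_n) : Prop := psd A /\ \tr A = 1.

Definition unitary (n : nat) (U : 'M[C]_n) : Prop := U *m adj U = 1%:M.

Definition ptrace2 (dS dE : nat) (X : 'M[C]_(dS * dE)) : 'M[C]_dS :=
  \matrix_(i, j) \sum_(e < dE) X (mxtens_index (i, e)) (mxtens_index (j, e)).

Definition blockop (k n : nat) (X : 'M[C]_(k * n)) (a b : 'I_k) : 'M[C]_n :=
  \matrix_(i, j) X (mxtens_index (a, i)) (mxtens_index (b, j)).

Definition ampl (n1 n2 : nat) (k : nat) (Phi : 'M[C]_n1 -> 'M[C]_n2)
    (X : 'M[C]_(k * n1)) : 'M[C]_(k * n2) :=
  \matrix_(p, q) Phi (blockop X (mxtens_unindex p).1 (mxtens_unindex q).1)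
                     (mxtens_unindex p).2 (mxtens_unindex q).2.

Definition positive_map (n1 n2 : nat) (Phi : 'M[C]_n1 -> 'M[C]_n2) : Prop :=
  forall X : 'M[C]_n1, psd X -> psd (Phi X).

Definition completely_positive (n1 n2 : nat) (Phi : 'M[C]_n1 -> 'M[C]_n2)
  : Prop :=
  forall (k : nat) (X : 'M[C]_(k * n1)), psd X -> psd (ampl Phi X).

Definition trace_preserving (n1 n2 : nat) (Phi : 'M[C]_n1 -> 'M[C]_n2)
  : Prop := forall X : 'M[C]_n1, \tr (Phi X) = \tr X.

(* The operator sigma_{R sL} (x) sigma_{sR E} on
   H_R (x) ((H_sL (x) H_sR) (x) H_E), index (r, ((x, y), e)). *)
Definition markov_block (dR a b dE : nat)
    (sL : 'M[C]_(dR * a)) (sR : 'M[C]_(b * dE)) : 'M[C]_(dR * ((a * b) * dE)) :=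
  \matrix_(p, q)
    let r := (mxtens_unindex p).1 in let r' := (mxtens_unindex q).1 in
    let xye := (mxtens_unindex p).2 in let xye' := (mxtens_unindex q).2 in
    let xy := (mxtens_unindex xye).1 in let xy' := (mxtens_unindex xye').1 in
    let e := (mxtens_unindex xye).2 in let e' := (mxtens_unindex xye').2 in
    sL (mxtens_index (r, (mxtens_unindex xy).1))
       (mxtens_index (r', (mxtens_unindex xy').1))
  * sR (mxtens_index ((mxtens_unindex xy).2, e))
       (mxtens_index ((mxtens_unindex xy').2, e')).

(* Markov state on H_R (x) H_S (x) H_E (index (r, (s, e))).
   The orthogonal decomposition H_S = (+)_k H_{s_k^L} (x) H_{s_k^R} is given
   by isometries W k : H_{s_k^L} (x) H_{s_k^R} -> H_S with mutually
   orthogonal ranges spanning H_S. *)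
Definition markov_state (dR dS dE : nat) (sigma : 'M[C]_(dR * (dS * dE)))
  : Prop :=
  exists (K : nat) (a b : 'I_K -> nat)
         (W : forall k : 'I_K, 'M[C]_(dS, a k * b k))
         (lam : 'I_K -> C)
         (sL : forall k : 'I_K, 'M[C]_(dR * a k))
         (sR : forall k : 'I_K, 'M[C]_(b k * dE)),
    [/\ (forall k : 'I_K, adj (W k) *m W k = 1%:M) /\
          (forall k l : 'I_K, k != l -> adj (W k) *m W l = 0),
        \sum_(k < K) W k *m adj (W k) = 1%:M,
        (forall k, 0 <= lam k) /\ \sum_(k < K) lam k = 1,
        (forall k, density (sL k) /\ density (sR k)) &
        sigma = \sum_(k < K) lam k *:
          (((1%:M : 'M[C]_dR) *t (W k *t (1%:M : 'M[C]_dE)))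
             *m markov_block (sL k) (sR k)
             *m adj ((1%:M : 'M[C]_dR) *t (W k *t (1%:M : 'M[C]_dE))))].

Definition omega_ref (m dSE : nat) (rho : 'I_m -> 'M[C]_dSE)
  : 'M[C]_(m * dSE) :=
  \sum_(l < m) (m%:R^-1 : C) *: (delta_mx l l *t rho l).

End QDefs.

(* Main.v *)
Require Import Defs.
From HB Require Import structures.
From mathcomp Require Import all_boot all_order all_algebra.
From mathcomp Require Import complex mxtens reals.
From mathcomp Require Import lra zify boolp.
Import Order.TTheory GRing.Theory Num.Theory.
Local Open Scope ring_scope.

(* Let sigma be the average of the rho_l. The sandwiched Renyi-2 quantity
   tr (sigma^-1/2 rho sigma^-1/2 rho) is nonincreasing under positive
   trace-preserving maps. Tr_E and LamP carry the pairs (rho_l, sigma) and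
   (Tr_E rho_l, Tr_E sigma) into each other, so it is preserved by Tr_E, and the
   equality case says that the Petz map of Tr_E at sigma, which is completely
   positive, recovers every rho_l. Composing this recovery with Tr_E gives a
   unital completely positive map on operators of S whose fixed points form a
   *-algebra stable under conjugation by sqrt(Tr_E sigma). The decomposition of
   S into blocks L (x) R on which this algebra is (+)_k L(L_k) (x) 1 then forces
   rho_l = (+)_k s_{l,k} (x) tau_k with tau_k independent of l. *)

(** * Positive semidefinite matrices *)

Section Psd.
Set Implicit Arguments.
Unset Strict Implicit.
Unset Printing Implicit Defensive.
Variable R : realType.
Local Notation C := (R[i]).
Implicit Types (m n p q : nat).

(** The quadratic form survives this restriction because its contraction needs only positivity of a
    map and of its trace dual. The state [sigma] may be singular, so every inverse root is a
    pseudo-inverse; the domination of each rho_l by m sigma supplies both the support inclusions and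
    the bound m on the whitened states. Stability under conjugation by the root lets X be moved
    across Q in rho_l = Q (X (x) 1) Q, which becomes (Y (x) 1) sigma. Hence on a block rho_l and
    sigma differ only on the factor L and share their factor on R and E. *)

Lemma adjE m n (A : 'M[C]_(m, n)) i j : adj A i j = (A j i)^*%C.
Proof. by rewrite !mxE. Qed.

Lemma adjK m n (A : 'M[C]_(m, n)) : adj (adj A) = A.
Proof. by apply/matrixP=> i j; rewrite !adjE conjcK. Qed.

Lemma adjD m n (A B : 'M[C]_(m, n)) : adj (A + B) = adj A + adj B.
Proof. by apply/matrixP=> i j; rewrite !mxE rmorphD. Qed.

Lemma adjN m n (A : 'M[C]_(m, n)) : adj (- A) = - adj A.
Proof. by apply/matrixP=> i j; rewrite !mxE rmorphN. Qed.

Lemma adjB m n (A B : 'M[C]_(m, n)) : adj (A - B) = adj A - adj B.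
Proof. by rewrite adjD adjN. Qed.

Lemma adjZ m n (c : C) (A : 'M[C]_(m, n)) : adj (c *: A) = c^*%C *: adj A.
Proof. by apply/matrixP=> i j; rewrite !mxE rmorphM. Qed.

Lemma adj0 m n : adj (0 : 'M[C]_(m, n)) = 0.
Proof. by apply/matrixP=> i j; rewrite !mxE conjc0. Qed.

Lemma adj1 n : adj (1%:M : 'M[C]_n) = 1%:M.
Proof. by apply/matrixP=> i j; rewrite !mxE conjc_nat eq_sym. Qed.

Lemma adjM m n p (A : 'M[C]_(m, n)) (B : 'M[C]_(n, p)) :
  adj (A *m B) = adj B *m adj A.
Proof. by rewrite /adj trmx_mul map_mxM. Qed.

Lemma adj_tens m n p q (A : 'M[C]_(m, n)) (B : 'M[C]_(p, q)) :
  adj (A *t B) = adj A *t adj B.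
Proof. by rewrite /adj trmx_tens map_mxT. Qed.

Lemma adj_sum m n (I : Type) (r : seq I) (P : pred I) (F : I -> 'M[C]_(m, n)) :
  adj (\sum_(i <- r | P i) F i) = \sum_(i <- r | P i) adj (F i).
Proof. exact: (big_morph _ (@adjD m n) (adj0 m n)). Qed.

Lemma adj_delta m n i j : adj (delta_mx i j : 'M[C]_(m, n)) = delta_mx j i.
Proof. by apply/matrixP=> k l; rewrite adjE !mxE conjc_nat andbC. Qed.

Lemma trace_gram m n (A : 'M[C]_(m, n)) :
  \tr (adj A *m A) = \sum_i \sum_j `|A j i| ^+ 2.
Proof.
apply: eq_bigr => i _; rewrite mxE; apply: eq_bigr => j _.
by rewrite adjE mulrC sqr_normc.
Qed.

Lemma trace_gram_eq0 m n (A : 'M[C]_(m, n)) : \tr (adj A *m A) = 0 -> A = 0.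
Proof.
rewrite trace_gram => /eqP; rewrite psumr_eq0 => [/allP A0|i _]; last first.
  by apply: sumr_ge0 => j _; rewrite exprn_ge0.
apply/matrixP => j i; rewrite mxE; move/(_ i (mem_index_enum i)): A0 => /=.
rewrite psumr_eq0 => [/allP/(_ j (mem_index_enum j))/=|k _].
  by rewrite sqrf_eq0 normr_eq0 => /eqP.
by rewrite exprn_ge0.
Qed.

Lemma gram_eq0 m n (A : 'M[C]_(m, n)) : adj A *m A = 0 -> A = 0.
Proof. by move=> A0; apply: trace_gram_eq0; rewrite A0 mxtrace0. Qed.

Lemma delta_sandwich m n (A : 'M[C]_(m, n)) i j :
  (adj (delta_mx i 0 : 'cV_m) *m A *m (delta_mx j 0 : 'cV_n)) 0 0 = A i j.
Proof. by rewrite adj_delta -rowE -colE !mxE. Qed.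

(** Polarization on e_i + c e_j: c = 1 gives A_ij = - A_ji, and c = 'i gives A_ij = A_ji. *)
Lemma quad_eq0 n (A : 'M[C]_n) :
  (forall v : 'cV_n, (adj v *m A *m v) 0 0 = 0) -> A = 0.
Proof.
move=> A0; apply/matrixP=> i j; rewrite mxE.
have E c : c^*%C * A j i + c * A i j = 0.
  have := A0 (delta_mx i 0 + c *: delta_mx j 0).
  rewrite adjD adjZ !mulmxDl !mulmxDr -!scalemxAl -!scalemxAr ![((_ + _)%R : 'M_1) 0 0]mxE.
  rewrite ![(_ *: _ : 'M_1) 0 0]mxE !delta_sandwich.
  have D k : A k k = 0 by rewrite -delta_sandwich.
  by rewrite !D !mulr0 add0r addr0 addrC.
have := E 1; have := E 'i%C.
have -> : ('i%C)^*%C = - ('i%C) :> C by apply/eqP; rewrite eq_complex /= oppr0 !eqxx.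
rewrite conjc1 !mul1r mulNr addrC => /eqP; rewrite subr_eq0 => /eqP.
have i0 : ('i%C : C) != 0 by rewrite eq_complex /= oner_eq0 andbF.
move/(mulfI i0) => ->; rewrite -mulr2n => /eqP.
by rewrite mulrn_eq0 => /eqP.
Qed.

Lemma conjc_ge0 (x : C) : 0 <= x -> x^*%C = x.
Proof. by move=> x0; exact: (CrealP (ger0_real x0)). Qed.

(** [psd] does not ask for hermiticity. Over the complex numbers a real quadratic form forces it, by
    polarization of A - adj A. *)
Lemma psd_herm n (A : 'M[C]_n) : psd A -> adj A = A.
Proof.
move=> pA; apply/eqP; rewrite -subr_eq0; apply/eqP/quad_eq0 => v.
rewrite mulmxBr mulmxBl [LHS]mxE [((- _)%R : 'M_1) 0 0]mxE.
have -> : adj v *m adj A *m v = adj (adj v *m A *m v).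
  by rewrite !adjM adjK mulmxA.
by rewrite adjE conjc_ge0 ?subrr.
Qed.

Lemma psd_gram m n (A : 'M[C]_(m, n)) : psd (adj A *m A).
Proof.
move=> v; have -> : adj v *m (adj A *m A) *m v = adj (A *m v) *m (A *m v).
  by rewrite adjM !mulmxA.
rewrite mxE sumr_ge0 // => j _.
by rewrite adjE mulrC mulcJ_ge0.
Qed.

Lemma psd_conj m n (A : 'M[C]_m) (B : 'M[C]_(m, n)) :
  psd A -> psd (adj B *m A *m B).
Proof. by move=> pA v; have := pA (B *m v); rewrite adjM !mulmxA. Qed.

Lemma psd_conj_adj m n (A : 'M[C]_m) (B : 'M[C]_(n, m)) :
  psd A -> psd (B *m A *m adj B).
Proof. by move=> pA; have := psd_conj (adj B) pA; rewrite adjK. Qed.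

Lemma psd_conj_herm n (A B : 'M[C]_n) :
  adj B = B -> psd A -> psd (B *m A *m B).
Proof. by move=> hB /(psd_conj B); rewrite hB. Qed.

Lemma psd0 n : psd (0 : 'M[C]_n).
Proof. by move=> v; rewrite mulmx0 mul0mx mxE. Qed.

Lemma psd_proj n (P : 'M[C]_n) : adj P = P -> P *m P = P -> psd P.
Proof. by move=> hP PP; have := psd_gram P; rewrite hP PP. Qed.

Lemma psdD n (A B : 'M[C]_n) : psd A -> psd B -> psd (A + B).
Proof. by move=> pA pB v; rewrite mulmxDr mulmxDl mxE addr_ge0. Qed.

Lemma psdZ n (c : C) (A : 'M[C]_n) : 0 <= c -> psd A -> psd (c *: A).
Proof. by move=> c0 pA v; rewrite -scalemxAr -scalemxAl mxE mulr_ge0. Qed.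

Lemma psd_sum n (I : Type) (r : seq I) (P : pred I) (F : I -> 'M[C]_n) :
  (forall i, P i -> psd (F i)) -> psd (\sum_(i <- r | P i) F i).
Proof.
by move=> pF; apply: big_ind => //; [exact: psd0 | exact: psdD].
Qed.

Lemma psd_trace n (A : 'M[C]_n) : psd A -> 0 <= \tr A.
Proof. by move=> pA; apply: sumr_ge0 => i _; rewrite -delta_sandwich. Qed.

Lemma psd_spectral n (A : 'M[C]_n) : psd A ->
  exists (U : 'M[C]_n) (d : 'rV[C]_n),
    [/\ adj U *m U = 1%:M, U *m adj U = 1%:M, (forall i, 0 <= d 0 i) &
        A = adj U *m diag_mx d *m U].
Proof.
move=> pA; have hA := psd_herm pA.
have nA : A \is normalmx by apply/normalmxP; rewrite -[map_mx _ _]/(adj A) hA.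
have uU := spectral_unitarymx A.
have /orthomx_spectralP := nA; rewrite invmx_unitary //.
set U := spectralmx A in uU *; set d := spectral_diag A => eA.
have UU : U *m adj U = 1%:M by apply/unitarymxP.
have UU' := mulmx1C UU.
exists U, d; split => // i.
have := pA (adj U *m delta_mx i 0).
have -> (e : 'cV_n) : adj (adj U *m e) *m A *m (adj U *m e)
     = adj e *m (U *m A *m adj U) *m e.
  by rewrite adjM adjK !mulmxA.
rewrite delta_sandwich eA -[map_mx _ _]/(adj U).
by rewrite !mulmxA UU mul1mx -mulmxA UU mulmx1 mxE eqxx mulr1n.
Qed.

(* G is the Moore-Penrose inverse of the square root Q, so that Q *m G is the
   support projection of A. *)
Definition sqrt_pinv n (A Q G : 'M[C]_n) : Prop :=
  [/\ psd Q /\ psd G, Q *m Q = A, G *m Q = Q *m G,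
      Q *m G *m Q = Q & G *m Q *m G = G].

Lemma psd_sqrt n (A : 'M[C]_n) : psd A -> exists Q G : 'M[C]_n, sqrt_pinv A Q G.
Proof.
move=> /psd_spectral [U [d [UU1 UU2 d0 ->]]].
(* Functional calculus f(A). With the convention 0^-1 = 0, the function x |-> (sqrt x)^-1 directly
   yields the pseudo-inverse. *)
pose S (f : C -> C) := adj U *m diag_mx (map_mx f d) *m U.
have SM f g : S f *m S g = S (fun x => f x * g x).
  rewrite /S !mulmxA -(mulmxA _ U) UU2 mulmx1 -(mulmxA (adj U) (diag_mx _) (diag_mx _)) mulmx_diag.
  by congr (_ *m diag_mx _ *m _); apply/matrixP=> i j; rewrite !mxE ord1.
have Seq f g : (forall x, 0 <= x -> f x = g x) -> S f = S g.
  move=> fg; congr (_ *m diag_mx _ *m _); apply/matrixP=> i j.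
  by rewrite !mxE fg // ord1.
have Spsd f : (forall x, 0 <= x -> 0 <= f x) -> psd (S f).
  move=> f0; rewrite /S; apply: psd_conj => v; rewrite -mulmxA mxE.
  apply: sumr_ge0 => i _; rewrite mul_diag_mx !mxE mulrCA mulr_ge0 ?f0 //.
  by rewrite mulrC mulcJ_ge0.
exists (S sqrtC), (S (fun x => (sqrtC x)^-1)); split.
- by split; apply: Spsd => x x0; rewrite ?invr_ge0 sqrtC_ge0.
- rewrite SM /S; congr (_ *m diag_mx _ *m _); apply/matrixP=> i j.
  by rewrite mxE -expr2 sqrtCK.
- by rewrite !SM; apply: Seq => x _; rewrite mulrC.
- rewrite !SM; apply: Seq => x _.
  by have [->|?] := eqVneq (sqrtC x) 0; rewrite ?mul0r // divff ?mul1r.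
- rewrite !SM; apply: Seq => x _.
  by have [->|?] := eqVneq (sqrtC x) 0; rewrite ?invr0 ?mulr0 // mulVf ?mul1r.
Qed.

Lemma psd_factor n (A : 'M[C]_n) : psd A -> exists2 B : 'M[C]_n, adj B = B & B *m B = A.
Proof. by move=> /psd_sqrt[Q [G [[/psd_herm hQ _] QQ _ _ _]]]; exists Q. Qed.

Lemma psd_trace_mul n (A B : 'M[C]_n) : psd A -> psd B -> 0 <= \tr (A *m B).
Proof.
move=> /psd_factor[D hD <-] pB; rewrite -mulmxA mxtrace_mulC.
exact/psd_trace/psd_conj_herm.
Qed.

Lemma psd_trace_sandwich_eq0 m n (A : 'M[C]_m) (B : 'M[C]_(m, n)) :
  psd A -> \tr (adj B *m A *m B) = 0 -> A *m B = 0.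
Proof.
move=> /psd_factor[D hD <-].
have -> : adj B *m (D *m D) *m B = adj (D *m B) *m (D *m B).
  by rewrite adjM hD !mulmxA.
by move/trace_gram_eq0 => DB; rewrite -mulmxA DB mulmx0.
Qed.

Lemma psd_trace_eq0 n (A : 'M[C]_n) : psd A -> \tr A = 0 -> A = 0.
Proof.
move=> pA t0; rewrite -[A]mulmx1; apply: psd_trace_sandwich_eq0 => //.
by rewrite adj1 mul1mx mulmx1.
Qed.

(** The trace of M^* A M is squeezed between 0 and c tr (M^* B M) = 0: the kernel of a dominating
    operator lies in that of the dominated one. *)
Lemma psd_dominated_mul0 m n (A B : 'M[C]_m) (M : 'M[C]_(m, n)) c :
  psd A -> psd (c *: B - A) -> B *m M = 0 -> A *m M = 0.
Proof.
move=> pA pBA BM; apply: psd_trace_sandwich_eq0 => //; apply/eqP.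
rewrite eq_le psd_trace ?andbT; last exact: psd_conj.
have := psd_trace (psd_conj M pBA).
rewrite mulmxBr mulmxBl linearB /= -scalemxAr -scalemxAl -[_ *m B *m M]mulmxA BM.
by rewrite mulmx0 scaler0 mxtrace0 sub0r oppr_ge0.
Qed.

Lemma psd_of_trace_ge0 n (A : 'M[C]_n) :
  (forall B, psd B -> 0 <= \tr (A *m B)) -> psd A.
Proof.
move=> h v; have := h (v *m adj v).
have -> : v *m adj v = adj (adj v) *m adj v by rewrite adjK.
move/(_ (psd_gram _)); rewrite adjK mulmxA mxtrace_mulC mulmxA.
by rewrite /mxtrace big_ord1.
Qed.

Lemma trace_mul_inj n (A B : 'M[C]_n) :
  (forall M, \tr (A *m M) = \tr (B *m M)) -> A = B.
Proof.
move=> h; apply/matrixP => i j.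
have E (M : 'M[C]_n) : \tr (M *m delta_mx j i) = M i j.
  have -> : delta_mx j i = delta_mx j 0 *m adj (delta_mx i (0 : 'I_1)) :> 'M[C]_n.
    by rewrite adj_delta mul_delta_mx.
  rewrite mulmxA mxtrace_mulC mulmxA /mxtrace big_ord1.
  exact: delta_sandwich.
by rewrite -!E.
Qed.
End Psd.

(** * Contraction of the KMS form by positive maps *)

Section LinearFunctions.
Set Implicit Arguments.
Unset Strict Implicit.
Variables (K : comNzRingType) (U V : lmodType K) (f : U -> V).
Hypothesis lf : linear f.

Lemma linD x y : f (x + y) = f x + f y.
Proof. by have := lf 1 x y; rewrite !scale1r. Qed.

Lemma lin0 : f 0 = 0.
Proof. by apply: (@addrI _ (f 0)); rewrite -linD !addr0. Qed.

Lemma linZ a x : f (a *: x) = a *: f x.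
Proof. by have := lf a x 0; rewrite !addr0 lin0 addr0. Qed.

Lemma linB x y : f (x - y) = f x - f y.
Proof. by rewrite -scaleN1r linD linZ scaleN1r. Qed.

Lemma lin_sum (I : Type) (r : seq I) (P : pred I) (F : I -> U) :
  f (\sum_(i <- r | P i) F i) = \sum_(i <- r | P i) f (F i).
Proof. exact: (big_morph _ linD lin0). Qed.
End LinearFunctions.

(** A positive first increment would persist by convexity and make u grow linearly, past any
    bound. *)
Lemma convex_bounded_decr (R : realType) (u : nat -> R) (M : R) :
  (forall n, u n <= M) -> (forall n, u n.+1 *+ 2 <= u n + u n.+2) ->
  u 1%N <= u 0%N.
Proof.
move=> uM uc; rewrite leNgt; apply/negP => lt01.
set d := u 1%N - u 0%N; have d0 : 0 < d by rewrite subr_gt0.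
have step n : d <= u n.+1 - u n.
  elim: n => [//|n IH]; apply: le_trans IH _.
  by have := uc n; lra.
have lin n : u 0%N + d *+ n <= u n.
  elim: n => [|n IH]; first by rewrite addr0.
  rewrite mulrSr addrA; apply: le_trans (lerD IH (step n)) _.
  by rewrite addrC subrK.
have M0 : 0 <= (M - u 0%N) / d.
  by apply: divr_ge0; [rewrite subr_ge0 uM | exact: ltW].
have := archi_boundP M0; set N := Num.bound _.
rewrite ltr_pdivrMr // ltrBlDl mulr_natl ltNge => /negP; apply.
exact: le_trans (lin N) (uM N).
Qed.

Section KMS.
Set Implicit Arguments.
Unset Strict Implicit.
Variable R : realType.
Local Notation C := (R[i]).
Variables (n1 n2 : nat) (Phi : 'M[C]_n1 -> 'M[C]_n2).
Variables (Phid : 'M[C]_n2 -> 'M[C]_n1).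
Hypotheses (Phi_lin : linear Phi) (Phid_lin : linear Phid).
Hypotheses (Phi_pos : positive_map Phi) (Phid_pos : positive_map Phid).
Hypothesis Phi_dual : forall X Y, \tr (Phid Y *m X) = \tr (Y *m Phi X).
Hypothesis Phid1 : Phid 1%:M = 1%:M.
Variables (Q : 'M[C]_n1) (G : 'M[C]_n2).
Hypotheses (pQ : psd Q) (hG : adj G = G).
(** An inequality rather than an equation: when Phi (Q^2) is singular, its whitening is only a
    projection. It makes [S] below subunital, which suffices. *)
Hypothesis GG : psd (1%:M - G *m Phi (Q *m Q) *m G).

(** [b] is the KMS form of Q^2. [S] is [Phid] after its KMS adjoint, so that b X (S Y) is the
    corresponding form on the output side. *)
Let b X Y := \tr (Q *m X *m Q *m Y).
Let S X := Phid (G *m Phi (Q *m X *m Q) *m G).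

Let Slin : linear S.
Proof.
move=> a X Y; rewrite /S mulmxDr -scalemxAr mulmxDl -scalemxAl Phi_lin.
by rewrite mulmxDr -scalemxAr mulmxDl -scalemxAl Phid_lin.
Qed.

Let Spos : positive_map S.
Proof.
move=> X pX; apply/Phid_pos/psd_conj_herm => //.
by apply/Phi_pos/psd_conj_herm => //; exact: psd_herm.
Qed.

Let Sbound c X : 0 <= c -> psd (c%:M - X) -> psd (c%:M - S X).
Proof.
move=> c0 pX.
have -> : c%:M - S X = S (c%:M - X) + c *: Phid (1%:M - G *m Phi (Q *m Q) *m G).
  rewrite (linB Slin) (linB Phid_lin) Phid1 -(scalemx1 _ c) (linZ Slin).
  by rewrite /S mulmx1 scalerBr [RHS]addrC addrA subrK.
by apply: psdD; [exact: Spos | apply/psdZ/Phid_pos].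
Qed.

Let bS X Y : b X (S Y) = \tr (Phi (Q *m X *m Q) *m G *m Phi (Q *m Y *m Q) *m G).
Proof.
by rewrite /b /S mxtrace_mulC Phi_dual mxtrace_mulC !mulmxA.
Qed.

Let bC X Y : b X Y = b Y X.
Proof. by rewrite /b -mulmxA mxtrace_mulC !mulmxA. Qed.

Let bSC X Y : b X (S Y) = b (S X) Y.
Proof. by rewrite bS (bC (S X)) bS -mulmxA mxtrace_mulC !mulmxA. Qed.

Let bBl X Y W : b (X - Y) W = b X W - b Y W.
Proof. by rewrite /b mulmxBr !mulmxBl linearB. Qed.

Let bB X Y : b (X - Y) (X - Y) = b X X - b X Y *+ 2 + b Y Y.
Proof.
rewrite bBl ![b _ (X - Y)]bC !bBl [b Y X]bC.
by rewrite opprB mulr2n opprD !addrA [RHS]addrAC.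
Qed.

Let b_ge0 X : adj X = X -> 0 <= b X X.
Proof.
by move=> hX; rewrite /b -!mulmxA psd_trace_mul // mulmxA; exact: psd_conj_herm.
Qed.

(** With D a root of Q, b X X is the squared Hilbert-Schmidt norm of D X D. As Q may be singular,
    only the part of X seen by Q vanishes. *)
Let b_eq0 X : adj X = X -> b X X = 0 -> Q *m X *m Q = 0.
Proof.
rewrite /b; have [D hD <-] := psd_factor pQ => hX.
have -> : \tr (D *m D *m X *m (D *m D) *m X)
    = \tr (adj (D *m X *m D) *m (D *m X *m D)).
  rewrite !adjM hD hX !mulmxA -!mulmxA mxtrace_mulC.
  by rewrite !mulmxA.
move/trace_gram_eq0 => DXD.
have -> : D *m D *m X *m (D *m D) = D *m (D *m X *m D) *m D by rewrite !mulmxA.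
by rewrite DXD mulmx0 mul0mx.
Qed.

(* S is self-adjoint for b and preserves the order interval [0, c], so
   k |-> b (S^k Z) (S^k Z) is convex and bounded, hence nonincreasing. *)
Lemma kms_contraction Z c : 0 <= c -> psd Z -> psd (c%:M - Z) ->
  \tr (Phi (Q *m Z *m Q) *m G *m Phi (Q *m Z *m Q) *m G)
    <= \tr (Q *m Z *m Q *m Z) /\
  (\tr (Phi (Q *m Z *m Q) *m G *m Phi (Q *m Z *m Q) *m G)
    = \tr (Q *m Z *m Q *m Z) ->
   Q *m Z *m Q = Q *m Phid (G *m Phi (Q *m Z *m Q) *m G) *m Q).
Proof.
move=> c0 pZ pcZ; rewrite -bS -/(b Z Z) -/(S Z).
pose T k := iter k S Z.
have pT k : psd (T k) by elim: k => //= k; exact: Spos.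
have pcT k : psd (c%:M - T k) by elim: k => //= k; exact: Sbound.
have hT k := psd_herm (pT k).
have hB (X Y : 'M[C]_n1) : psd X -> psd Y -> adj (X - Y) = X - Y.
  by move=> /psd_herm hX /psd_herm hY; rewrite adjB hX hY.
have ge0_le (x y : C) : x <= y -> complex.Re x <= complex.Re y by rewrite lecE => /andP[].
have real_b k : 0 <= b (T k) (T k) by apply: b_ge0.
have bnd k : b (T k) (T k) <= c * (c * \tr (Q *m Q)).
  have /psd_trace_mul/(_ (pcT k)) : psd (Q *m T k *m Q).
    by apply: psd_conj_herm => //; exact: psd_herm.
  rewrite mulmxBr linearB /= subr_ge0 => /le_trans; apply.
  rewrite mul_mx_scalar linearZ /= ler_wpM2l //.
  have /psd_trace_mul/(_ (pcT k)) : psd (Q *m Q).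
    by rewrite -{1}(psd_herm pQ); exact: psd_gram.
  rewrite mulmxBr linearB /= subr_ge0 mul_mx_scalar linearZ /=.
  by rewrite [\tr (Q *m T k *m Q)]mxtrace_mulC mulmxA.
(* Expand b on T k - T k.+2; by self-adjointness one S moves across the cross term and turns it into
   b (T k.+1) (T k.+1). *)
have conv k : b (T k.+1) (T k.+1) *+ 2 <= b (T k) (T k) + b (T k.+2) (T k.+2).
  have := b_ge0 (hB _ _ (pT k) (pT k.+2)).
  by rewrite bB [X in X *+ 2]bSC addrAC subr_ge0.
have le10 : b (T 1%N) (T 1%N) <= b (T 0%N) (T 0%N).
  rewrite lecE !ger0_Im // eqxx /=.
  apply: (@convex_bounded_decr _ (fun k => complex.Re (b (T k) (T k)))
    (complex.Re (c * (c * \tr (Q *m Q))))).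
    by move=> k; apply: ge0_le.
  move=> k; have := ge0_le _ _ (conv k); rewrite !mulr2n.
  by case: (b _ _) => ? ?; case: (b _ _) => ? ?; case: (b _ _).
(* Positivity of b on Z - S Z, with b (S Z) (S Z) <= b Z Z, bounds b Z (S Z) by b Z Z. In the
   equality case b on Z - S Z is <= 0, hence zero. *)
have sq := b_ge0 (hB _ _ (pT 0%N) (pT 1%N)).
move: sq le10; rewrite bB /= => sq le10; split.
  have : b Z (S Z) *+ 2 <= b Z Z *+ 2.
    rewrite addrAC subr_ge0 in sq; apply: le_trans sq _.
    by rewrite mulr2n lerD2l.
  by rewrite ler_pMn2r.
move=> e; apply/eqP; rewrite -subr_eq0 -mulmxBl -mulmxBr; apply/eqP/b_eq0.
  exact: hB (pT 0%N) (pT 1%N).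
apply/eqP; rewrite eq_le bB sq andbT e mulr2n opprD addrA subrr add0r addrC.
by rewrite subr_le0.
Qed.
End KMS.

(** * Tensor products, partial traces and complete positivity *)

Section Tensor.
Set Implicit Arguments.
Unset Strict Implicit.
Unset Printing Implicit Defensive.
Variable R : realType.
Local Notation C := (R[i]).
Implicit Types (m n p q d : nat).

(** [insl a] is |a> (x) 1 and [insr e] below is 1 (x) |e>. Blocks, partial traces and A (x) 1 become
    products with these isometries, so index computations turn into matrix algebra and Kraus forms
    appear. *)
Definition insl d k (a : 'I_k) : 'M[C]_(k * d, d) :=
  \matrix_(r, i) (r == mxtens_index (a, i))%:R.

Definition insr d n (e : 'I_d) : 'M[C]_(n * d, n) :=
  \matrix_(r, i) (r == mxtens_index (i, e))%:R.

Lemma mxtens_index_eq m n (i i' : 'I_m) (j j' : 'I_n) :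
  (mxtens_index (i, j) == mxtens_index (i', j')) = (i == i') && (j == j').
Proof. by rewrite (can_eq (@mxtens_indexK m n)) xpair_eqE. Qed.

Lemma mulmx_insl d k p (a : 'I_k) (X : 'M[C]_(p, k * d)) r i :
  (X *m insl d a) r i = X r (mxtens_index (a, i)).
Proof.
rewrite mxE (bigD1 (mxtens_index (a, i))) //= mxE eqxx mulr1 big1 ?addr0 // => s.
by move=> /negPf ns; rewrite mxE ns mulr0.
Qed.

Lemma mulmx_insr d n p (e : 'I_d) (X : 'M[C]_(p, n * d)) r i :
  (X *m insr n e) r i = X r (mxtens_index (i, e)).
Proof.
rewrite mxE (bigD1 (mxtens_index (i, e))) //= mxE eqxx mulr1 big1 ?addr0 // => s.
by move=> /negPf ns; rewrite mxE ns mulr0.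
Qed.

Lemma adj_insl_mulmx d k p (a : 'I_k) (X : 'M[C]_(k * d, p)) r i :
  (adj (insl d a) *m X) i r = X (mxtens_index (a, i)) r.
Proof. by rewrite -[X in LHS]adjK -adjM adjE mulmx_insl adjE conjcK. Qed.

Lemma adj_insr_mulmx d n p (e : 'I_d) (X : 'M[C]_(n * d, p)) r i :
  (adj (insr n e) *m X) i r = X (mxtens_index (i, e)) r.
Proof. by rewrite -[X in LHS]adjK -adjM adjE mulmx_insr adjE conjcK. Qed.

Lemma tens1_insl k p q (K : 'M[C]_(p, q)) (a : 'I_k) :
  (1%:M *t K) *m insl q a = insl p a *m K.
Proof.
apply/matrixP => r j; rewrite mulmx_insl.
case: (mxtens_indexP r) => b i; rewrite tensmxE [RHS]mxE.
under eq_bigr => l _ do rewrite mxE mxtens_index_eq.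
rewrite mxE; have [_|_] := eqVneq b a; last first.
  by rewrite mul0r big1 // => l _; rewrite mul0r.
rewrite mul1r (bigD1 i) //= eqxx mul1r big1 ?addr0 // => l.
by rewrite eq_sym => /negPf ->; rewrite mul0r.
Qed.

Lemma tens1_insr d p q (K : 'M[C]_(p, q)) (e : 'I_d) :
  (K *t 1%:M) *m insr q e = insr p e *m K.
Proof.
apply/matrixP => r j; rewrite mulmx_insr.
case: (mxtens_indexP r) => i f; rewrite tensmxE [RHS]mxE.
under eq_bigr => l _ do rewrite mxE mxtens_index_eq.
rewrite mxE; have [_|_] := eqVneq f e; last first.
  by rewrite mulr0 big1 // => l _; rewrite andbF mul0r.
rewrite mulr1 (bigD1 i) //= eqxx mul1r big1 ?addr0 // => l.
by rewrite eq_sym => /negPf ->; rewrite mul0r.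
Qed.

Lemma sum_insr d n : \sum_(e < d) insr n e *m adj (insr n e) = 1%:M.
Proof.
apply/matrixP => r s; rewrite summxE.
case: (mxtens_indexP r) => i f; case: (mxtens_indexP s) => j g.
under eq_bigr => e _.
  rewrite mxE; under eq_bigr => k _ do rewrite adjE !mxE !mxtens_index_eq conjc_nat.
  over.
rewrite (bigD1 f) //= [X in _ + X]big1 ?addr0 => [|e /negPf ne]; last first.
  by rewrite big1 // => k _; rewrite [f == e]eq_sym ne andbF mul0r.
rewrite (bigD1 i) //= !eqxx mul1r big1 ?addr0 => [|k /negPf nk]; last first.
  by rewrite [i == k]eq_sym nk mul0r.
by rewrite mxE mxtens_index_eq ![_ == i]eq_sym [_ == f]eq_sym.
Qed.

Lemma tens1E d n (A : 'M[C]_n) :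
  A *t (1%:M : 'M_d) = \sum_(e < d) insr n e *m A *m adj (insr n e).
Proof.
rewrite -[LHS]mulmx1 -sum_insr mulmx_sumr; apply: eq_bigr => e _.
by rewrite mulmxA tens1_insr.
Qed.

Lemma ptrace2E n d (X : 'M[C]_(n * d)) :
  ptrace2 X = \sum_(e < d) adj (insr n e) *m X *m insr n e.
Proof.
apply/matrixP => i j; rewrite mxE summxE; apply: eq_bigr => e _.
by rewrite mulmx_insr adj_insr_mulmx.
Qed.

Lemma blockopE k d (X : 'M[C]_(k * d)) (a b : 'I_k) :
  blockop X a b = adj (insl d a) *m X *m insl d b.
Proof. by apply/matrixP => i j; rewrite mxE mulmx_insl adj_insl_mulmx. Qed.

Lemma ptrace2_linear n d : linear (@ptrace2 R n d).
Proof.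
move=> c X Y; rewrite !ptrace2E scaler_sumr -big_split /=; apply: eq_bigr => e _.
by rewrite mulmxDr mulmxDl -scalemxAr -scalemxAl.
Qed.

Lemma tens1_linear n d : linear (fun A : 'M[C]_n => A *t (1%:M : 'M[C]_d)).
Proof. by move=> c X Y; apply/matrixP => i j; rewrite !mxE mulrDl mulrA. Qed.

Lemma tens1_mul n p q d (A : 'M[C]_(n, p)) (B : 'M[C]_(p, q)) :
  (A *m B) *t (1%:M : 'M[C]_d) = (A *t 1%:M) *m (B *t 1%:M).
Proof. by rewrite tensmx_mul mulmx1. Qed.

Lemma tens11 n d : (1%:M : 'M[C]_n) *t (1%:M : 'M[C]_d) = 1%:M.
Proof.
apply/matrixP => r s; case: (mxtens_indexP r) => i f; case: (mxtens_indexP s) => j g.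
by rewrite tensmxE !mxE mxtens_index_eq -natrM mulnb.
Qed.

Lemma adj_tens1 n p d (A : 'M[C]_(n, p)) :
  adj (A *t (1%:M : 'M[C]_d)) = adj A *t 1%:M.
Proof. by rewrite adj_tens adj1. Qed.

Lemma ptrace2_adj n d (X : 'M[C]_(n * d)) : ptrace2 (adj X) = adj (ptrace2 X).
Proof.
by rewrite !ptrace2E adj_sum; apply: eq_bigr => e _; rewrite !adjM adjK mulmxA.
Qed.

Lemma ptrace2_mulr n d (X : 'M[C]_(n * d)) (A : 'M[C]_n) :
  ptrace2 (X *m (A *t 1%:M)) = ptrace2 X *m A.
Proof.
rewrite !ptrace2E mulmx_suml; apply: eq_bigr => e _.
by rewrite -!mulmxA tens1_insr.
Qed.

Lemma ptrace2_mull n d (X : 'M[C]_(n * d)) (A : 'M[C]_n) :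
  ptrace2 ((A *t 1%:M) *m X) = A *m ptrace2 X.
Proof.
apply: (can_inj (@adjK _ _ _)); rewrite -ptrace2_adj !adjM adj_tens1.
by rewrite ptrace2_mulr ptrace2_adj.
Qed.

Lemma trace_ptrace2 n d (X : 'M[C]_(n * d)) : \tr (ptrace2 X) = \tr X.
Proof.
rewrite ptrace2E -[in RHS](mulmx1 X) -sum_insr mulmx_sumr !linear_sum /=.
by apply: eq_bigr => e _; rewrite -mulmxA mxtrace_mulC mulmxA.
Qed.

Lemma ptrace2_dual n d (X : 'M[C]_(n * d)) (Y : 'M[C]_n) :
  \tr ((Y *t 1%:M) *m X) = \tr (Y *m ptrace2 X).
Proof. by rewrite -ptrace2_mull trace_ptrace2. Qed.

Lemma ptrace2_psd n d (X : 'M[C]_(n * d)) : psd X -> psd (ptrace2 X).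
Proof. by move=> pX; rewrite ptrace2E; apply: psd_sum => e _; exact: psd_conj. Qed.

Lemma tens1_psd n d (A : 'M[C]_n) : psd A -> psd (A *t (1%:M : 'M[C]_d)).
Proof. by move=> pA; rewrite tens1E; apply: psd_sum => e _; exact: psd_conj_adj. Qed.

Lemma cp_conj p q (K : 'M[C]_(p, q)) :
  completely_positive (fun X : 'M[C]_q => K *m X *m adj K).
Proof.
move=> k X pX.
suff -> : ampl (fun X => K *m X *m adj K) X
    = ((1%:M : 'M_k) *t K) *m X *m adj ((1%:M : 'M_k) *t K) by exact: psd_conj_adj.
apply/matrixP => r s; rewrite mxE.
case: (mxtens_indexP r) => a i; case: (mxtens_indexP s) => b j.
rewrite !mxtens_indexK /= blockopE -mulmx_insl -adj_insl_mulmx.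
have -> Z : adj (insl p a) *m ((1%:M *t K) *m X *m Z *m insl p b)
   = K *m adj (insl q a) *m X *m (Z *m insl p b).
  rewrite !mulmxA; congr (_ *m _ *m _ *m _).
  by rewrite -[K in RHS]adjK -adjM -[insl q a *m _]tens1_insl adjM adj_tens adj1 adjK.
congr (fun_of_matrix _ _ _).
rewrite -!mulmxA; congr (_ *m (_ *m (_ *m _))).
by rewrite adj_tens adj1 tens1_insl.
Qed.

Lemma cp_sum p q (I : Type) (r : seq I) (F : I -> 'M[C]_q -> 'M[C]_p) :
  (forall i, completely_positive (F i)) ->
  completely_positive (fun X => \sum_(i <- r) F i X).
Proof.
move=> cF k X pX.
have -> : ampl (fun X => \sum_(i <- r) F i X) X = \sum_(i <- r) ampl (F i) X.
  by apply/matrixP => i j; rewrite mxE !summxE; apply: eq_bigr => l _; rewrite mxE.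
by apply: psd_sum => i _; exact: cF.
Qed.

Lemma cp_add p q (F G : 'M[C]_q -> 'M[C]_p) :
  completely_positive F -> completely_positive G ->
  completely_positive (fun X => F X + G X).
Proof.
move=> cF cG k X pX.
have -> : ampl (fun X => F X + G X) X = ampl F X + ampl G X.
  by apply/matrixP => i j; rewrite !mxE.
by apply: psdD; [exact: cF | exact: cG].
Qed.

Lemma cp_comp p q s (F : 'M[C]_q -> 'M[C]_p) (G : 'M[C]_s -> 'M[C]_q) :
  completely_positive F -> completely_positive G ->
  completely_positive (fun X => F (G X)).
Proof.
move=> cF cG k X pX.
have -> : ampl (fun X => F (G X)) X = ampl F (ampl G X).
  apply/matrixP => i j; rewrite !mxE; congr (fun_of_matrix (F _) _ _).
  by apply/matrixP => a b; rewrite !mxE !mxtens_indexK.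
by apply: cF; exact: cG.
Qed.

Lemma cp_ext p q (F G : 'M[C]_q -> 'M[C]_p) :
  F =1 G -> completely_positive F -> completely_positive G.
Proof.
move=> FG cF k X pX.
have -> : ampl G X = ampl F X by apply/matrixP => i j; rewrite !mxE FG.
exact: cF.
Qed.

Lemma cp_ptrace2 n d : completely_positive (@ptrace2 R n d).
Proof.
apply: (@cp_ext _ _ (fun X => \sum_(e < d) adj (insr n e) *m X *m adj (adj (insr n e)))).
  by move=> X; rewrite ptrace2E; apply: eq_bigr => e _; rewrite adjK.
by apply: cp_sum => e; exact: cp_conj.
Qed.

Lemma cp_tens1 n d : completely_positive (fun A : 'M[C]_n => A *t (1%:M : 'M[C]_d)).
Proof.
apply: (@cp_ext _ _ (fun X => \sum_(e < d) insr n e *m X *m adj (insr n e))).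
  by move=> X; rewrite tens1E.
by apply: cp_sum => e; exact: cp_conj.
Qed.

(** A measure-and-prepare map, with Kraus operators B |j><i| P where B is a root of A; P being a
    projection gives tr (P X) = tr (P X P). *)
Lemma cp_trace_prepare p q (P : 'M[C]_q) (A : 'M[C]_p) :
  adj P = P -> P *m P = P -> psd A ->
  completely_positive (fun X : 'M[C]_q => \tr (P *m X) *: A).
Proof.
move=> hP PP /psd_factor[B hB <-].
apply: (@cp_ext _ _ (fun X => \sum_(i < q) \sum_(j < p)
    (B *m delta_mx j i *m P) *m X *m adj (B *m delta_mx j i *m P))); last first.
  by apply: cp_sum => i; apply: cp_sum => j; exact: cp_conj.
have BB : B *m B = \sum_j B *m delta_mx j j *m B.
  by rewrite -mulmx_suml -mulmx_sumr -mx1_sum_delta mulmx1.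
move=> X; rewrite -PP -mulmxA mxtrace_mulC PP BB /mxtrace scaler_suml.
apply: eq_bigr => i _; rewrite scaler_sumr; apply: eq_bigr => j _.
rewrite !adjM hP hB adj_delta.
have -> : B *m delta_mx j i *m P *m X *m (P *m (delta_mx i j *m B))
   = B *m (delta_mx j i *m (P *m X *m P) *m delta_mx i j) *m B by rewrite !mulmxA.
rewrite scalemxAl scalemxAr; congr (_ *m _ *m _).
apply/matrixP => a b; rewrite !mxE.
rewrite (bigD1 i) //= big1 ?addr0 => [|k /negPf nk]; last by rewrite !mxE nk mulr0.
rewrite !mxE eqxx (bigD1 i) //= big1 ?addr0 => [|k /negPf nk]; last first.
  by rewrite !mxE nk andbF mul0r.
by rewrite !mxE eqxx andbT /= mulrAC mulrC -natrM mulnb.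
Qed.

(** The adjoint for the bilinear pairing tr (Y X), without conjugation; its entries come from
    testing on matrix units. *)
Definition dual_map n1 n2 (Phi : 'M[C]_n1 -> 'M[C]_n2) (B : 'M[C]_n2) : 'M[C]_n1 :=
  \matrix_(i, j) \tr (B *m Phi (delta_mx j i)).

Section Dual.
Variables (n1 n2 : nat) (Phi : 'M[C]_n1 -> 'M[C]_n2).
Hypothesis Phi_lin : linear Phi.

Lemma dual_mapP X Y : \tr (dual_map Phi Y *m X) = \tr (Y *m Phi X).
Proof.
rewrite [in RHS](matrix_sum_delta X) (lin_sum Phi_lin) mulmx_sumr linear_sum /=.
transitivity (\sum_i \sum_k dual_map Phi Y i k * X k i).
  by apply: eq_bigr => i _; rewrite mxE.
rewrite exchange_big /=; apply: eq_bigr => k _.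
rewrite (lin_sum Phi_lin) mulmx_sumr linear_sum /=; apply: eq_bigr => i _.
by rewrite (linZ Phi_lin) -scalemxAr mxtraceZ mxE mulrC.
Qed.

Lemma dual_map_linear : linear (dual_map Phi).
Proof.
move=> c X Y; apply/matrixP => i j.
by rewrite !mxE mulmxDl -scalemxAl mxtraceD mxtraceZ.
Qed.

Lemma dual_map_positive : positive_map Phi -> positive_map (dual_map Phi).
Proof.
move=> pPhi X pX; apply: psd_of_trace_ge0 => B pB.
by rewrite dual_mapP; apply: psd_trace_mul => //; exact: pPhi.
Qed.

Lemma dual_map_unital : trace_preserving Phi -> dual_map Phi 1%:M = 1%:M.
Proof.
by move=> tPhi; apply: trace_mul_inj => M; rewrite dual_mapP !mul1mx tPhi.
Qed.
End Dual.
End Tensor.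

(** * The Petz recovery map *)

Section Petz.
Set Implicit Arguments.
Unset Strict Implicit.
Unset Printing Implicit Defensive.
Variable R : realType.
Local Notation C := (R[i]).

Section SqrtPinv.
Variables (n : nat) (A Q G : 'M[C]_n).
Hypothesis AQG : sqrt_pinv A Q G.

Lemma sqrt_pinv_whiten : G *m A *m G = Q *m G.
Proof.
case: AQG => _ <- GQ QGQ GQG.
by rewrite mulmxA -mulmxA GQ -mulmxA (mulmxA G) GQG.
Qed.

Lemma sqrt_pinv_proj : adj (Q *m G) = Q *m G /\ (Q *m G) *m (Q *m G) = Q *m G.
Proof.
case: AQG => -[/psd_herm hQ /psd_herm hG] _ GQ QGQ GQG.
by rewrite adjM hQ hG GQ mulmxA QGQ.
Qed.

Lemma psd_compl_proj (P : 'M[C]_n) : adj P = P -> P *m P = P -> psd (1%:M - P).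
Proof.
move=> hP PP; apply: psd_proj; first by rewrite adjB adj1 hP.
by rewrite mulmxBr mulmx1 mulmxBl mul1mx PP subrr subr0.
Qed.

Lemma sqrt_pinv_compl_psd : psd (1%:M - G *m A *m G).
Proof. by rewrite sqrt_pinv_whiten; case: sqrt_pinv_proj; apply: psd_compl_proj. Qed.

Lemma dominated_supp (B : 'M[C]_n) c :
  psd B -> psd (c *: A - B) -> B *m (Q *m G) = B /\ (Q *m G) *m B = B.
Proof.
move=> pB pAB; have [hP PP] := sqrt_pinv_proj.
have BP : B *m (Q *m G) = B.
  apply/eqP; rewrite -subr_eq0 -oppr_eq0 opprB -{1}[B]mulmx1 -mulmxBr; apply/eqP.
  apply: psd_dominated_mul0 pB pAB _; case: AQG => _ <- GQ QGQ GQG.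
  by rewrite mulmxBr mulmx1 -mulmxA -GQ (mulmxA Q G) QGQ subrr.
by split=> //; rewrite -[RHS](psd_herm pB) -[in RHS]BP adjM hP psd_herm.
Qed.

(** G B G is the whitened B, and A whitens to the support projection, so c - G B G is the whitened c
    A - B plus c times the complementary projection. Domination puts B inside the support, so
    whitening is reversible. *)
Lemma dominated_whiten (B : 'M[C]_n) c : 0 <= c -> psd B -> psd (c *: A - B) ->
  [/\ psd (G *m B *m G), psd (c%:M - G *m B *m G) &
      Q *m (G *m B *m G) *m Q = B].
Proof.
move=> c0 pB pAB; have [hP PP] := sqrt_pinv_proj.
have [BP PB] := dominated_supp pB pAB.
have [[pQ pG] QQ GQ QGQ GQG] := AQG.
split; first by apply: psd_conj_herm => //; exact: psd_herm.
  have -> : c%:M - G *m B *m G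
      = G *m (c *: A - B) *m G + c *: (1%:M - G *m A *m G).
    rewrite mulmxBr mulmxBl -scalemxAr -scalemxAl scalerBr scalemx1.
    by rewrite [RHS]addrC addrA subrK.
  apply: psdD; first by apply: psd_conj_herm => //; exact: psd_herm.
  by apply: psdZ => //; exact: sqrt_pinv_compl_psd.
by rewrite !mulmxA PB -mulmxA GQ BP.
Qed.
End SqrtPinv.

Section Recovery.
Variables (dS dE : nat) (Lam : 'M[C]_dS -> 'M[C]_(dS * dE)).
Hypotheses (Lam_lin : linear Lam) (Lam_tp : trace_preserving Lam).
Hypothesis Lam_pos : positive_map Lam.
Variables (sigma Q G : 'M[C]_(dS * dE)) (q g : 'M[C]_dS).
Hypotheses (sQG : sqrt_pinv sigma Q G) (sqg : sqrt_pinv (ptrace2 sigma) q g).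
Hypothesis Lam_sigma : Lam (ptrace2 sigma) = sigma.

(* Both Tr_E and the positive map Lam contract the quadratic form
   tr (B sigma^-1/2 B sigma^-1/2) of the sandwiched Renyi-2 divergence, so on
   states exchanged by them equality holds; equality for Tr_E is exactly
   recovery by the Petz map. *)
Lemma petz_recovery (rho : 'M[C]_(dS * dE)) c : 0 <= c -> psd rho ->
  psd (c *: sigma - rho) -> Lam (ptrace2 rho) = rho ->
  rho = Q *m ((g *m ptrace2 rho *m g) *t 1%:M) *m Q.
Proof.
move=> c0 prho prs Lrho.
have prho' := ptrace2_psd prho.
have prs' : psd (c *: ptrace2 sigma - ptrace2 rho).
  by rewrite -(linZ (@ptrace2_linear _ _ _)) -(linB (@ptrace2_linear _ _ _)); exact: ptrace2_psd.
have [pZ pcZ QZQ] := dominated_whiten sQG c0 prho prs.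
have [pY pcY qYq] := dominated_whiten sqg c0 prho' prs'.
have [[pQ pG] QQ _ _ _] := sQG; have [[pq pg] qq _ _ _] := sqg.
have := @kms_contraction _ _ _ _ _ (@ptrace2_linear _ _ _) (@tens1_linear _ _ _)
  (@ptrace2_psd _ _ _) (@tens1_psd _ _ _) (@ptrace2_dual _ _ _) (@tens11 _ _ _)
  Q g pQ (psd_herm pg).
rewrite QQ => /(_ (sqrt_pinv_compl_psd sqg) _ _ c0 pZ pcZ).
rewrite QZQ => -[le1 eq1].
have := @kms_contraction _ _ _ _ _ Lam_lin (dual_map_linear Lam)
  Lam_pos (dual_map_positive Lam_lin Lam_pos) (dual_mapP Lam_lin)
  (dual_map_unital Lam_lin Lam_tp) q G pq (psd_herm pG).
rewrite qq Lam_sigma => /(_ (sqrt_pinv_compl_psd sQG) _ _ c0 pY pcY).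
rewrite qYq Lrho => -[le2 _].
(* Up to cyclicity, [le1] and [le2] compare tr (rho G rho G) with its reduced counterpart in
   opposite directions. *)
apply: eq1; apply: le_anti; rewrite le1 /=.
by move: le2; rewrite !mulmxA.
Qed.
End Recovery.
End Petz.

(** * Block decomposition of *-algebras of matrices *)

Section StarAlgebra.
Set Implicit Arguments.
Unset Strict Implicit.
Unset Printing Implicit Defensive.

Lemma ex_argmin (T : Type) (P : T -> Prop) (f : T -> nat) :
  (exists x, P x) -> exists2 x, P x & forall y, P y -> (f x <= f y)%N.
Proof.
case=> x0; have [k] := ubnP (f x0); elim: k x0 => // k IH x0 fx0 Px0.
have [[y [Py lt_y]]|no] := pselect (exists y, P y /\ (f y < f x0)%N).
  by apply: (IH y) => //; exact: leq_trans lt_y _.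
exists x0 => // y Py; rewrite leqNgt; apply/negP => lt_y.
by apply: no; exists y.
Qed.

Variable R : realType.
Local Notation C := (R[i]).

(** Equal ranks would give A = Y M A for some Y, hence A X = 0. This is the rank drop played against
    minimality below. *)
Lemma mxrank_mulmx_lt n k (M A : 'M[C]_n) (X : 'M[C]_(n, k)) :
  M *m A *m X = 0 -> A *m X != 0 -> (\rank (M *m A) < \rank A)%N.
Proof.
move=> MAX AX; have le := submxMl M A.
have := mxrank_leqif_sup le; rewrite ltn_neqAle => -[-> ->]; rewrite andbT.
by apply: contra AX => /submxP[Y ->]; rewrite -mulmxA MAX mulmx0.
Qed.

Lemma proj_isometry n (P : 'M[C]_n) : adj P = P -> P *m P = P ->
  exists b (V : 'M[C]_(n, b)),
    [/\ b = \rank P, adj V *m V = 1%:M & V *m adj V = P].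
Proof.
move=> hP PP; pose B := schmidt (row_base P).
have BB : B *m adj B = 1%:M.
  by apply/unitarymxP/schmidt_unitarymx/rank_leq_col.
have [/submxP[Y BY] /submxP[Z PZ]] : (B <= P)%MS /\ (P <= B)%MS.
  have e := eqmx_schmidt_free (row_base_free P).
  by rewrite /B !e !(eq_row_base P).
exists (\rank P), (adj B); rewrite adjK; split=> //.
have BP : B *m P = B by rewrite BY -mulmxA PP.
have PB : P *m (adj B *m B) = P by rewrite {1}PZ mulmxA -(mulmxA Z) BB mulmx1.
have PBB : adj B *m B *m P = P.
  by have := congr1 (@adj R n n) PB; rewrite !adjM adjK hP.
by rewrite -[LHS]mulmxA BP in PBB.
Qed.

Section Insl.
Variables (a b : nat).
Implicit Types (x y : 'I_a).

Lemma adj_insl_insl x y :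
  adj (insl R b x) *m insl R b y = ((x == y)%:R)%:M.
Proof.
apply/matrixP => i j; rewrite adj_insl_mulmx !mxE mxtens_index_eq.
by case: (i == j); case: (x == y).
Qed.

Lemma adj_insl_tens x (A : 'M[C]_a) :
  adj (insl R b x) *m (A *t 1%:M) = \sum_y A x y *: adj (insl R b y).
Proof.
apply/matrixP => i r; rewrite adj_insl_mulmx summxE.
case: (mxtens_indexP r) => y j; rewrite tensmxE.
rewrite (bigD1 y) //= big1 ?addr0 => [|z /negPf nz].
  by rewrite !mxE mxtens_index_eq eqxx conjc_nat [j == i]eq_sym.
by rewrite !mxE mxtens_index_eq [y == z]eq_sym nz conjc0 mulr0.
Qed.

Lemma sum_insl : \sum_(x < a) insl R b x *m adj (insl R b x) = 1%:M.
Proof.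
apply/matrixP => r s; rewrite summxE.
case: (mxtens_indexP r) => x i; case: (mxtens_indexP s) => y j.
rewrite (bigD1 x) //= [X in _ + X]big1 ?addr0 => [|z /negPf nz]; last first.
  rewrite mxE big1 // => k _.
  by rewrite !mxE mxtens_index_eq [x == z]eq_sym nz mul0r.
rewrite mxE (bigD1 i) //= [X in _ + X]big1 ?addr0 => [|k /negPf nk]; last first.
  by rewrite !mxE mxtens_index_eq [i == k]eq_sym nk andbF mul0r.
by rewrite !mxE !mxtens_index_eq !eqxx mul1r conjc_nat ![_ == x]eq_sym ![_ == i]eq_sym.
Qed.
End Insl.

Variable n : nat.
Implicit Types (F : 'M[C]_n -> Prop) (X Y : 'M[C]_n).

Definition star_algebra F : Prop :=
  [/\ F 0, forall c X Y, F X -> F Y -> F (c *: X + Y),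
      forall X Y, F X -> F Y -> F (X *m Y) & forall X, F X -> F (adj X)].

Record block := Block {
  blockL : nat;
  blockR : nat;
  blockW : 'M[C]_(n, blockL * blockR) }.

(** The third clause makes the range of W invariant, with F acting as A (x) 1 on it; the fourth puts
    the full matrix algebra of the block, extended by zero, back inside F. *)
Definition block_of F (B : block) : Prop :=
  let W := blockW B in
  [/\ (0 < blockL B)%N /\ (0 < blockR B)%N, adj W *m W = 1%:M,
      forall X, F X -> exists A, X *m W = W *m (A *t 1%:M) &
      forall A, F (W *m (A *t 1%:M) *m adj W)].

Section OneBlock.
Variable F : 'M[C]_n -> Prop.
Hypothesis sF : star_algebra F.

Let F0 : F 0. Proof. by case: sF. Qed.
Let FD X Y : F X -> F Y -> F (X + Y).
Proof. by case: sF => _ h _ _ FX FY; rewrite -[X]scale1r; exact: h. Qed.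
Let FZ c X : F X -> F (c *: X).
Proof. by case: sF => _ h _ _ FX; rewrite -[_ *: _]addr0; exact: h. Qed.
Let FB X Y : F X -> F Y -> F (X - Y).
Proof. by move=> FX FY; rewrite -scaleN1r; apply/FD/FZ. Qed.
Let FM X Y : F X -> F Y -> F (X *m Y). Proof. by case: sF => _ _ h _; exact: h. Qed.
Let FA X : F X -> F (adj X). Proof. by case: sF => _ _ _ h; exact: h. Qed.
Let Fsum (I : Type) (r : seq I) (G : I -> 'M[C]_n) :
  (forall i, F (G i)) -> F (\sum_(i <- r) G i).
Proof. by move=> FG; apply: big_ind. Qed.

(* A nonzero element of minimal rank: any element of F of smaller rank
   vanishes, which forces y^* y to be a multiple of a projection. *)
Lemma minimal_projection : (exists2 X, F X & X != 0) ->
  exists p, [/\ F p, p != 0, adj p = p, p *m p = p &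
    forall X, F X -> (\rank X < \rank p)%N -> X = 0].
Proof.
case=> X0 FX0 X00.
have [|y [Fy y0] ymin] := @ex_argmin _ (fun X => F X /\ X != 0) mxrank.
  by exists X0.
have small X : F X -> (\rank X < \rank y)%N -> X = 0.
  move=> FX lt; apply/eqP; apply/negPn/negP => X1.
  by have := ymin X (conj FX X1); rewrite leqNgt lt.
pose s := adj y *m y.
have Fs : F s by apply/FM => //; exact: FA.
have s0 : s != 0 by apply: contra y0 => /eqP/gram_eq0 ->.
have rs : (\rank s <= \rank y)%N by exact/mxrankS/submxMl.
have [U [d [UU1 UU2 d0 es]]] := psd_spectral (psd_gram y).
rewrite -/s in es.
have [i di] : exists i, d 0 i != 0.
  apply/existsP; rewrite -negb_forall; apply: contra s0 => /forallP d00.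
  rewrite es; suff -> : d = 0 by rewrite linear0 mulmx0 mul0mx.
  by apply/rowP => j; rewrite mxE; apply/eqP.
set c := d 0 i in di; pose x : 'cV[C]_n := adj U *m delta_mx i 0.
have sx : s *m x = c *: x.
  rewrite es /x !mulmxA -(mulmxA _ U) UU2 mulmx1 -mulmxA.
  suff -> : diag_mx d *m delta_mx i 0 = c *: (delta_mx i 0 : 'cV[C]_n).
    by rewrite -scalemxAr.
  apply/matrixP => j k; rewrite mul_diag_mx !mxE.
  by have [->|] := eqVneq j i; rewrite ?mulr0.
have x0 : x != 0.
  apply/eqP => /(congr1 (mulmx U)); rewrite /x mulmxA UU2 mul1mx mulmx0.
  move=> /matrixP/(_ i 0); rewrite !mxE !eqxx /= => /eqP.
  by rewrite oner_eq0.
(* The eigenvector x is killed by (s - c) s but not by s, so this element of F has rank below that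
   of s and must vanish. *)
have ss : s *m s = c *: s.
  have e : (s - c%:M) *m s = s *m s - c *: s by rewrite mulmxBl mul_scalar_mx.
  apply/eqP; rewrite -subr_eq0 -e; apply/eqP/small.
    by rewrite e; apply: FB; [exact: FM | exact: FZ].
  apply: leq_trans rs; apply: (@mxrank_mulmx_lt _ _ _ _ x).
    by rewrite e mulmxBl -mulmxA sx -scalemxAr sx -scalemxAl sx subrr.
  by rewrite sx scaler_eq0 negb_or di.
have c0 : 0 <= c by exact: d0.
have hs : adj s = s by rewrite /s adjM adjK.
exists (c^-1 *: s); split.
- exact: FZ.
- by rewrite scaler_eq0 negb_or invr_eq0 di.
- by rewrite adjZ hs conjc_ge0 // invr_ge0.
- by rewrite -scalemxAl -scalemxAr ss !scalerA -mulrA mulVf // mulr1.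
- move=> X FX lt; apply: small => //; apply: leq_trans lt _.
  by apply: leq_trans rs; rewrite mxrank_scale_nz // invr_eq0.
Qed.

Section Corner.
Variable p : 'M[C]_n.
Hypotheses (Fp : F p) (p0 : p != 0) (hp : adj p = p) (pp : p *m p = p).
Hypothesis pmin : forall X, F X -> (\rank X < \rank p)%N -> X = 0.

Let tr_p : 0 < \tr p.
Proof.
have pp' := psd_proj hp pp.
rewrite lt_neqAle psd_trace // andbT eq_sym.
by apply: contra p0 => /eqP/psd_trace_eq0 ->.
Qed.

(** The corner p F p is one-dimensional: subtracting from X an eigenvalue times p, with eigenvector
    in the range of p, drops the rank below that of p. *)
Lemma corner_scalar X : F X -> p *m X *m p = X -> X = (\tr X / \tr p) *: p.
Proof.
move=> FX pXp; have [b [V [bp VV Vp]]] := proj_isometry hp pp.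
suff [c Xc] : exists c, X = c *: p.
  by rewrite {2}Xc linearZ /= mulfK ?gt_eqF.
have rp : (0 < b)%N by rewrite bp lt0n mxrank_eq0.
(* [eigenvalueP] yields a row eigenvector; starting from the adjoint gives a column eigenvector of
   the compressed X, for the conjugate of a. *)
have [a /eigenvalueP[v va v0]] := eigenvalue_closed (adj V *m adj X *m V) rp.
have {}va : adj V *m X *m V *m adj v = a^*%C *: adj v.
  by rewrite -adjZ -va !adjM !adjK !mulmxA.
have {}v0 : adj v != 0 by apply: contra v0 => /eqP e; rewrite -[v]adjK e adj0.
set w := adj v in va v0; exists a^*%C; apply/eqP; rewrite -subr_eq0.
have Xp : X *m p = X by rewrite -[in LHS]pXp -mulmxA pp pXp.
have pX : p *m X = X by rewrite -[in LHS]pXp !mulmxA pp pXp.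
have e : (X - a^*%C%:M) *m p = X - a^*%C *: p.
  by rewrite mulmxBl mul_scalar_mx Xp.
rewrite -e; apply/eqP/pmin; first by rewrite e; apply: FB => //; exact: FZ.
have pV : p *m V = V by rewrite -Vp -mulmxA VV mulmx1.
have XV : X *m V *m w = a^*%C *: (V *m w).
  by rewrite scalemxAr -va !mulmxA Vp pX.
apply: (@mxrank_mulmx_lt _ _ _ _ (V *m w)).
  by rewrite e mulmxBl !mulmxA XV -!scalemxAl pV subrr.
rewrite mulmxA pV; apply: contra v0 => /eqP Vw.
by rewrite -[w]mul1mx -VV -mulmxA Vw mulmx0.
Qed.

(** Partial isometries in F with common initial projection p and orthogonal final projections: the
    first column of a system of matrix units. *)
Definition orthonormal_frame a (u : 'I_a -> 'M[C]_n) : Prop :=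
  [/\ forall x, F (u x), forall x, u x *m p = u x &
      forall x y, adj (u x) *m u y = (x == y)%:R *: p].

Section Frame.
Variables (a : nat) (u : 'I_a -> 'M[C]_n).
Hypothesis ou : orthonormal_frame u.
Variables (b : nat) (V : 'M[C]_(n, b)).
Hypotheses (b_gt0 : (0 < b)%N) (VV : adj V *m V = 1%:M) (Vp : V *m adj V = p).

(** The isometry |x> (x) v |-> u_x V v; conjugation by it carries A (x) 1 to the sum of A_xy u_x
    u_y^*. *)
Definition frame_mx : 'M[C]_(n, a * b) :=
  \sum_x u x *m V *m adj (insl R b x).

Lemma frame_mx_insl y : frame_mx *m insl R b y = u y *m V.
Proof.
rewrite mulmx_suml (bigD1 y) //= big1 ?addr0 => [|x /negPf nx].
  by rewrite -mulmxA adj_insl_insl eqxx mulmx1.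
by rewrite -mulmxA adj_insl_insl nx -scalemx1 scale0r mulmx0.
Qed.

Lemma frame_mx_isometry : adj frame_mx *m frame_mx = 1%:M.
Proof.
have [Fu up uu] := ou.
have VpV : adj V *m p *m V = 1%:M by rewrite -Vp !mulmxA VV mul1mx VV.
rewrite {2}/frame_mx mulmx_sumr -(sum_insl a b); apply: eq_bigr => x _.
rewrite -[LHS]mul1mx -(sum_insl a b) mulmx_suml (bigD1 x) //=.
have E y : insl R b y *m adj (insl R b y) *m
    (adj frame_mx *m (u x *m V *m adj (insl R b x)))
  = (y == x)%:R *: (insl R b y *m adj (insl R b x)).
  rewrite !mulmxA -(mulmxA _ (adj (insl _ _ y)) (adj frame_mx)) -adjM frame_mx_insl.
  rewrite adjM !mulmxA -(mulmxA _ (adj (u y))) uu -scalemxAr -!scalemxAl.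
  congr (_ *: _); rewrite -[X in X *m _ = _]mulmxA -[X in X *m _ = _]mulmxA.
  by rewrite (mulmxA (adj V)) VpV mulmx1.
rewrite E eqxx scale1r big1 ?addr0 // => y /negPf ny.
by rewrite E ny scale0r.
Qed.

Lemma frame_bound : (a <= n)%N.
Proof.
have := mxrankM_maxr (adj frame_mx) frame_mx.
rewrite frame_mx_isometry mxrank1 => /leq_trans/(_ (rank_leq_row _)).
by apply: leq_trans; rewrite leq_pmulr.
Qed.

Lemma frame_mx_tens (A : 'M[C]_a) :
  frame_mx *m (A *t 1%:M)
    = \sum_x \sum_y A x y *: (u x *m V *m adj (insl R b y)).
Proof.
rewrite mulmx_suml; apply: eq_bigr => x _.
rewrite -mulmxA adj_insl_tens mulmx_sumr; apply: eq_bigr => y _.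
by rewrite -scalemxAr.
Qed.
End Frame.

(** Gram-Schmidt with values in the corner: the residue Y has Y^* Y = c p by [corner_scalar], so a
    nonzero Y, divided by sqrt c, would lengthen a maximal frame. *)
Lemma frame_complete a (u : 'I_a -> 'M[C]_n) : orthonormal_frame u ->
  (forall v : 'I_a.+1 -> 'M[C]_n, ~ orthonormal_frame v) ->
  forall X, F X -> X *m p = X -> X = \sum_x u x *m (adj (u x) *m X).
Proof.
move=> [Fu up uu] umax X FX Xp; apply/eqP; rewrite -subr_eq0; apply/negPn/negP.
set Y := X - _ => Y0.
have FY : F Y by apply: FB => //; apply: Fsum => x; apply/FM/FM => //; exact: FA.
have Yp : Y *m p = Y.
  rewrite mulmxBl Xp; congr (_ - _); rewrite mulmx_suml.
  by apply: eq_bigr => x _; rewrite -!mulmxA Xp.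
have pu x : p *m adj (u x) = adj (u x) by rewrite -{1}hp -adjM up.
have uY x : adj (u x) *m Y = 0.
  rewrite mulmxBr mulmx_sumr (bigD1 x) //= big1 ?addr0 => [|y /negPf ny].
    by rewrite !mulmxA uu eqxx scale1r pu subrr.
  by rewrite !mulmxA uu eq_sym ny scale0r !mul0mx.
have FYY : F (adj Y *m Y) by apply/FM => //; exact: FA.
have YYp : p *m (adj Y *m Y) *m p = adj Y *m Y.
  by rewrite -!mulmxA Yp mulmxA -{1}hp -adjM Yp.
have := corner_scalar FYY YYp; set c := _ / _ => YY.
have c0 : 0 <= c by rewrite divr_ge0 ?(ltW tr_p) // psd_trace //; exact: psd_gram.
have cn0 : c != 0.
  by apply: contra Y0 => /eqP c00; apply/eqP/gram_eq0; rewrite YY c00 scale0r.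
pose t := (sqrtC c)^-1.
have t0 : 0 <= t by rewrite invr_ge0 sqrtC_ge0.
pose v i := if unlift ord0 i is Some x then u x else t *: Y.
apply: (umax v); split.
- by move=> i; rewrite /v; case: unliftP => [x|] _ //; exact: FZ.
- by move=> i; rewrite /v; case: unliftP => [x|] _ //; rewrite -scalemxAl Yp.
- move=> i j; rewrite /v; case: unliftP => [x|] ->; case: unliftP => [y|] ->.
  + by rewrite uu (inj_eq (@lift_inj _ _)).
  + by rewrite -scalemxAr uY scaler0 [_ == _]eq_sym (negPf (neq_lift _ _)) scale0r.
  + by rewrite -[u y]adjK -adjM -scalemxAr uY scaler0 adj0
      (negPf (neq_lift _ _)) scale0r.
  + rewrite eqxx adjZ -scalemxAl -scalemxAr YY !scalerA conjc_ge0 //.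
    by congr (_ *: _); rewrite /t -invfM -expr2 sqrtCK; exact: mulVf.
Qed.
End Corner.

Lemma ex_block : (exists2 X, F X & X != 0) -> exists B, block_of F B.
Proof.
case/minimal_projection => p [Fp p0 hp pp pmin].
have [b [V [bp VV Vp]]] := proj_isometry hp pp.
have b_gt0 : (0 < b)%N by rewrite bp lt0n mxrank_eq0.
pose P a := exists u : 'I_a -> 'M[C]_n, orthonormal_frame p u.
have bound a : P a -> (a <= n)%N.
  by case=> u ou; exact: (frame_bound ou b_gt0 VV Vp).
have P1 : P 1%N.
  exists (fun=> p); split=> // x y; by rewrite !ord1 eqxx scale1r hp pp.
(* A frame of maximal length, found by minimizing n - a; truncated subtraction is harmless because
   [bound] gives a <= n. *)
have [|a [u ou] amax] := @ex_argmin _ P (fun a => (n - a)%N).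
  by exists 1%N.
have a_max k : P k -> (k <= a)%N.
  by move=> Pk; have := amax k Pk; have := bound k Pk; have := bound a (ex_intro _ u ou); lia.
have umax (v : 'I_a.+1 -> 'M[C]_n) : ~ orthonormal_frame p v.
  by move=> ov; have := a_max _ (ex_intro _ v ov); rewrite ltnn.
have [Fu up uu] := ou.
have pu x : p *m adj (u x) = adj (u x) by rewrite -{1}hp -adjM up.
exists (Block (frame_mx u V)); split => /=.
- by split=> //; exact: a_max.
- exact: frame_mx_isometry.
(* By completeness X u_y is the sum of u_x (u_x^* X u_y), and each bracket lies in the corner, hence
   is a scalar times p. *)
- move=> X FX; exists (\matrix_(x, y) (\tr (adj (u x) *m (X *m u y)) / \tr p)).
  rewrite frame_mx_tens exchange_big /= mulmx_sumr; apply: eq_bigr => y _.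
  have FXu : F (X *m u y) by exact: FM.
  rewrite !mulmxA {1}(frame_complete Fp p0 hp pp pmin ou umax FXu) -?mulmxA ?up //.
  rewrite !mulmx_suml; apply: eq_bigr => x _; rewrite mxE.
  rewrite {1}(corner_scalar Fp p0 hp pp pmin (X := adj (u x) *m (X *m u y))).
  + by rewrite -scalemxAr up -!scalemxAl !mulmxA.
  + by apply: FM => //; exact: FA.
  + by rewrite !mulmxA pu -!mulmxA up.
- move=> A; rewrite frame_mx_tens mulmx_suml; apply: Fsum => x.
  rewrite mulmx_suml; apply: Fsum => y.
  rewrite -scalemxAl -!mulmxA -adjM frame_mx_insl adjM !mulmxA -(mulmxA _ V) Vp up.
  by apply/FZ/FM => //; exact: FA.
Qed.
End OneBlock.

Definition orthogonal_blocks K (B : 'I_K -> block) : Prop :=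
  forall i j, i != j -> adj (blockW (B i)) *m blockW (B j) = 0.

(** Centrality: the range of z is invariant under F, and under adjoints too, so its complement is
    invariant as well. *)
Lemma block_proj F B : block_of F B ->
  let z := blockW B *m adj (blockW B) in
  [/\ F z, adj z = z, z *m z = z, z != 0 &
    star_algebra F -> forall X, F X -> X *m z = z *m X].
Proof.
case=> -[a0 b0] WW WX FW z.
have hz : adj z = z by rewrite adjM adjK.
have zz : z *m z = z by rewrite mulmxA -(mulmxA _ _ (blockW B)) WW mulmx1.
split=> //.
- by have := FW 1%:M; rewrite tens11 mulmx1.
- apply/eqP => z0; have := mxrankM_maxr (adj (blockW B)) (blockW B).
  rewrite WW mxrank1 => le; have : blockW B = 0.
    by rewrite -[blockW B]mulmx1 -WW mulmxA -/z z0 mul0mx.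
  by move=> W0; move: le; rewrite W0 mxrank0 leqNgt muln_gt0 a0 b0.
- move=> [_ _ _ FA].
  have zXz X : F X -> z *m X *m z = X *m z.
    move=> /WX[A XW]; rewrite /z !mulmxA -(mulmxA _ X) XW.
    by rewrite -!mulmxA (mulmxA (adj _) (blockW B)) WW mul1mx.
  clearbody z => X FX; rewrite -zXz //; have := congr1 (@adj R n n) (zXz _ (FA _ FX)).
  by rewrite !adjM adjK hz mulmxA.
Qed.

(* Peel off one block at a time; what remains is the *-algebra (1 - z) F. *)
Theorem star_algebra_blocks F e : star_algebra F -> F e ->
  (forall X, F X -> e *m X = X) ->
  exists K (B : 'I_K -> block),
    [/\ forall i, block_of F (B i), orthogonal_blocks B &
        \sum_i blockW (B i) *m adj (blockW (B i)) = e].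
Proof.
(* Induction on the rank of the unit e, kept general because after removal of a block the remaining
   algebra has unit e - z. *)
have [k] := ubnP (\rank e); elim: k F e => // k IH F e rk sF Fe eX.
have [F0 FL FM FA] := sF.
have [noX|/existsNP[X0 /not_implyP[FX0 X00]]] := pselect (forall X, F X -> X = 0).
  by exists 0%N, (fun i : 'I_0 => Block (0 : 'M_(n, 0 * 0))); split => [[]|[]|] //;
    rewrite big_ord0 (noX e Fe).
have [|B0 bB0] := ex_block sF; first by exists X0 => //; exact/eqP.
have [Fz hz zz z0 /(_ sF) zC] := block_proj bB0.
have [_ WW0 WX0 FW0] := bB0.
set z := _ *m _ in Fz hz zz z0 zC.
have FB X Y : F X -> F Y -> F (X - Y).
  by move=> FX FY; rewrite addrC -scaleN1r; exact: FL.
pose F' X := F X /\ z *m X = 0.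
have sF' : star_algebra F'.
  split; first by split=> //; rewrite mulmx0.
  - move=> c X Y [FX zX] [FY zY]; split; first exact: FL.
    by rewrite mulmxDr -scalemxAr zX zY scaler0 addr0.
  - by move=> X Y [FX zX] [FY zY]; split; [exact: FM | rewrite mulmxA zX mul0mx].
  - move=> X [FX zX]; split; first exact: FA.
    by rewrite -{1}hz -adjM zC // zX adj0.
have ze : e *m z = z by exact: eX.
have F'e : F' (e - z).
  by split; [exact: FB | rewrite mulmxBr zz -zC // ze subrr].
have [||K [B [bB oB sB]]] := IH F' (e - z) _ sF' F'e.
- move: rk; rewrite ltnS; apply: leq_trans; have -> : e - z = (1%:M - z) *m e.
    by rewrite mulmxBl mul1mx -zC // ze.
  apply: (@mxrank_mulmx_lt _ _ _ _ z); last by rewrite ze.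
  by rewrite -mulmxA ze mulmxBl mul1mx zz subrr.
- by move=> X [FX zX]; rewrite mulmxBl zX subr0 eX.
have zB i : z *m blockW (B i) = 0.
  have [_ WW _ FW] := bB i; have [_] := FW 1%:M.
  rewrite tens11 mulmx1 mulmxA => h.
  by rewrite -[LHS]mulmx1 -WW mulmxA h mul0mx.
pose B' i := if unlift ord0 i is Some j then B j else B0.
have W0B i : adj (blockW B0) *m blockW (B i) = 0.
  by rewrite -[adj _]mul1mx -WW0 -!mulmxA (mulmxA _ _ (blockW _)) zB mulmx0.
exists K.+1, B'; split.
- move=> i; rewrite /B'; case: unliftP => [j|] _ //.
  have [ab WW WX FW] := bB j; split=> // [X FX|A]; last by have [] := FW A.
  (* The inductive block speaks only about elements annihilated by z; X and X - z X act alike on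
     it. *)
  have [|A XW] := WX (X - z *m X).
    by split; [apply/FB/FM | rewrite mulmxBr mulmxA zz subrr].
  by exists A; rewrite -XW mulmxBl -zC // -mulmxA zB mulmx0 subr0.
- move=> i j; rewrite /B'; case: unliftP => [x|] ->; case: unliftP => [y|] -> //.
  + by rewrite (inj_eq (@lift_inj _ _)); exact: oB.
  + by move=> _; rewrite -[LHS]adjK adjM adjK W0B adj0.
- rewrite big_ord_recl /B' unlift_none.
  under eq_bigr => i _ do rewrite liftK.
  by rewrite sB addrC subrK.
Qed.
End StarAlgebra.

(** * The fixed-point algebra of Petz recovery *)

Section FixedAlgebra.
Set Implicit Arguments.
Unset Strict Implicit.
Unset Printing Implicit Defensive.
Variable R : realType.
Local Notation C := (R[i]).
Variables (n d : nat) (sigma Q G : 'M[C]_(n * d)) (q g : 'M[C]_n).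
Hypotheses (sQG : sqrt_pinv sigma Q G) (sqg : sqrt_pinv (ptrace2 sigma) q g).
Local Notation t1 X := (X *t (1%:M : 'M[C]_d)).
Implicit Types X Y : 'M[C]_n.

(** Recovery followed by Tr_E, in whitened coordinates X = g Y g. With K = Q (g (x) 1) it is Tr_E
    (K^* (X (x) 1) K), the form exploited below. *)
Definition petz_fix X : 'M[C]_n := g *m ptrace2 (Q *m t1 X *m Q) *m g.

Let p := q *m g.
Let K := Q *m t1 g.

Let hQ : adj Q = Q. Proof. by case: sQG => -[/psd_herm]. Qed.
Let hq : adj q = q. Proof. by case: sqg => -[/psd_herm]. Qed.
Let hg : adj g = g. Proof. by case: sqg => -[_ /psd_herm]. Qed.
Let QQ : Q *m Q = sigma. Proof. by case: sQG. Qed.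
Let qq : q *m q = ptrace2 sigma. Proof. by case: sqg. Qed.
Let gq : g *m q = p. Proof. by case: sqg. Qed.
Let pq : p *m q = q. Proof. by case: sqg. Qed.
Let qp : q *m p = q. Proof. by rewrite -gq mulmxA; case: sqg. Qed.
Let pg : p *m g = g. Proof. by rewrite -gq; case: sqg. Qed.
Let gp : g *m p = g. Proof. by rewrite /p mulmxA; case: sqg. Qed.
Let hp : adj p = p. Proof. by case: (sqrt_pinv_proj sqg). Qed.
Let pp : p *m p = p. Proof. by case: (sqrt_pinv_proj sqg). Qed.

(** The squared norm of Q ((1 - p) (x) 1) is the trace of Tr_E sigma against 1 - p, which is
    zero. *)
Lemma sqrt_supp : Q *m t1 p = Q /\ t1 p *m Q = Q.
Proof.
have e : Q *m t1 p = Q.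
  apply/eqP; rewrite -subr_eq0 -oppr_eq0 opprB -{1}[Q]mulmx1 -mulmxBr.
  rewrite -(tens11 R n d) -(linB (@tens1_linear R n d)); apply/eqP/trace_gram_eq0.
  have hM : adj (1%:M - p) = 1%:M - p by rewrite adjB adj1 hp.
  rewrite adjM adj_tens1 hM hQ -mulmxA mxtrace_mulC -!mulmxA -tens1_mul.
  rewrite mulmxA QQ mxtrace_mulC ptrace2_dual -qq -mulmxA (mulmxA _ q q).
  by rewrite [X in X *m q]mulmxBl mul1mx pq subrr mul0mx mulmx0 mxtrace0.
by split=> //; rewrite -{2}hQ -{2}e adjM adj_tens1 hQ hp.
Qed.

Let Qp : Q *m t1 p = Q. Proof. by case: sqrt_supp. Qed.
Let pQ : t1 p *m Q = Q. Proof. by case: sqrt_supp. Qed.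

Let fixK X : ptrace2 (adj K *m t1 X *m K) = petz_fix X.
Proof.
rewrite adjM adj_tens1 hQ hg /petz_fix -ptrace2_mull -ptrace2_mulr.
by rewrite /K !mulmxA.
Qed.

Let fix_lin : linear petz_fix.
Proof.
move=> c X Y; rewrite /petz_fix tens1_linear mulmxDr -scalemxAr mulmxDl.
by rewrite -scalemxAl ptrace2_linear mulmxDr -scalemxAr mulmxDl -scalemxAl.
Qed.

Let fix_adj X : petz_fix (adj X) = adj (petz_fix X).
Proof.
by rewrite /petz_fix !adjM hg -ptrace2_adj !adjM hQ adj_tens1 !mulmxA.
Qed.

Let fix_p : petz_fix p = p.
Proof. by rewrite /petz_fix Qp QQ -qq mulmxA gq pq. Qed.

Let fix_supp X : petz_fix X = X -> p *m X = X /\ X *m p = X.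
Proof.
by move=> <-; rewrite /petz_fix; split; [rewrite !mulmxA pg | rewrite -(mulmxA _ g p) gp].
Qed.

Let fix_trace X : \tr (ptrace2 sigma *m petz_fix X) = \tr (ptrace2 sigma *m X).
Proof.
rewrite /petz_fix; set T := ptrace2 (Q *m _ *m _).
have -> : ptrace2 sigma *m (g *m T *m g) = q *m (p *m T *m g).
  by rewrite -qq !mulmxA.
rewrite mxtrace_mulC -(mulmxA _ g q) gq mxtrace_mulC mulmxA pp -ptrace2_dual.
by rewrite !mulmxA pQ mxtrace_mulC mulmxA QQ mxtrace_mulC ptrace2_dual mxtrace_mulC.
Qed.

(** The Schwarz defect of a fixed X is Tr_E (M^* M), with M the commutator of K and X (x) 1. Its
    expectation in the invariant functional Tr_E sigma is zero, and this functional is faithful on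
    the support p, so M vanishes. *)
Let fix_comm X : petz_fix X = X -> K *m t1 X = t1 X *m K.
Proof.
move=> fX; have [pX Xp] := fix_supp fX.
have fX' : petz_fix (adj X) = adj X by rewrite fix_adj fX.
apply/eqP; rewrite -subr_eq0; apply/eqP; set M := _ - _.
have Mp : M *m t1 p = M.
  have Kp : K *m t1 p = K by rewrite /K -mulmxA -tens1_mul gp.
  by rewrite mulmxBl -(mulmxA K) -tens1_mul Xp -(mulmxA _ K) Kp.
have DM : ptrace2 (adj M *m M) = petz_fix (adj X *m X) - adj X *m X.
  have -> : adj M *m M =
      t1 (adj X) *m (adj K *m K) *m t1 X - t1 (adj X) *m (adj K *m t1 X *m K)
      - (adj K *m t1 (adj X) *m K *m t1 X - adj K *m t1 (adj X *m X) *m K).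
    rewrite adjB !adjM adj_tens1 mulmxBl !mulmxBr tens1_mul !mulmxA.
    by [].
  rewrite !(linB (@ptrace2_linear R n d)) !ptrace2_mulr !ptrace2_mull !fixK fX fX'.
  have -> : ptrace2 (adj K *m K) = p.
    have pK : t1 p *m K = K by rewrite /K mulmxA pQ.
    by have := fixK p; rewrite -(mulmxA (adj K)) pK fix_p.
  by rewrite -mulmxA pX subrr sub0r opprB.
have Mq : M *m t1 q = 0.
  apply: trace_gram_eq0; rewrite adjM adj_tens1 hq !mulmxA mxtrace_mulC !mulmxA.
  rewrite -tens1_mul -mulmxA ptrace2_dual DM mulmxBr linearB /=.
  by rewrite qq fix_trace subrr.
by rewrite -Mp tens1_mul mulmxA Mq mul0mx.
Qed.

Let fix_mul X Y : petz_fix X = X -> petz_fix Y = Y -> petz_fix (X *m Y) = X *m Y.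
Proof.
move=> fX fY; rewrite -fixK tens1_mul -!(mulmxA (adj K)) -(mulmxA (t1 X)).
rewrite -(fix_comm fY) (mulmxA (t1 X)) (mulmxA (adj K)) ptrace2_mulr.
by rewrite (mulmxA (adj K)) fixK fX.
Qed.

(** Only the corner under p has to be fixed; the part off the support of Tr_E sigma is free. Thus 1
    belongs to the algebra and the blocks fill all of H_S. *)
Definition petz_algebra X : Prop := p *m X = X *m p /\ petz_fix (X *m p) = X *m p.

Lemma petz_algebra_star : star_algebra petz_algebra.
Proof.
split.
- by split; rewrite !(mul0mx, mulmx0) // (lin0 fix_lin).
- move=> c X Y [pX fX] [pY fY]; split.
    by rewrite mulmxDr mulmxDl -scalemxAl -scalemxAr pX pY.
  by rewrite mulmxDl -scalemxAl fix_lin fX fY.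
- move=> X Y [pX fX] [pY fY]; split; first by rewrite mulmxA pX -mulmxA pY mulmxA.
  have -> : X *m Y *m p = (X *m p) *m (Y *m p).
    by rewrite -[RHS]mulmxA (mulmxA p) pY -(mulmxA Y) pp mulmxA.
  exact: fix_mul.
- move=> X [pX fX]; split; first by rewrite -{1}hp -adjM -pX adjM hp.
  by rewrite -{1 2}hp -adjM pX fix_adj fX.
Qed.

Lemma petz_algebra1 : petz_algebra 1%:M.
Proof. by split; rewrite ?mulmx1 mul1mx. Qed.

(** The partner is X' = g X q: write Q = K (q (x) 1) and move X across K by [fix_comm]. *)
Lemma petz_algebra_modular X : petz_algebra X ->
  exists2 X', petz_algebra X' & t1 X *m Q = Q *m t1 X'.
Proof.
move=> [pX fX].
have Kq : K *m t1 q = Q by rewrite /K -mulmxA -tens1_mul gq Qp.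
have e : t1 X *m Q = Q *m t1 (g *m X *m q).
  have -> : t1 X *m Q = t1 (X *m p) *m Q by rewrite tens1_mul -mulmxA pQ.
  rewrite -[in LHS]Kq mulmxA -(fix_comm fX) -(mulmxA K) -tens1_mul -(mulmxA X) pq.
  by rewrite /K -mulmxA -tens1_mul mulmxA.
exists (g *m X *m q) => //.
have supp : g *m X *m q *m p = g *m X *m q by rewrite -mulmxA qp.
split; first by rewrite supp !mulmxA pg.
rewrite supp /petz_fix -e -(mulmxA _ Q Q) ptrace2_mull QQ -qq !mulmxA.
by rewrite -(mulmxA _ q g) -/p -(mulmxA _ q p) qp.
Qed.

Lemma petz_algebra_whiten rho :
  rho = Q *m t1 (g *m ptrace2 rho *m g) *m Q -> petz_algebra (g *m ptrace2 rho *m g).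
Proof.
move=> e; have supp : g *m ptrace2 rho *m g *m p = g *m ptrace2 rho *m g.
  by rewrite -mulmxA gp.
split; first by rewrite supp !mulmxA pg.
by rewrite supp /petz_fix -e.
Qed.
End FixedAlgebra.

(** * Tensor factorization and Markov states *)

Section TensorFactor.
Set Implicit Arguments.
Unset Strict Implicit.
Unset Printing Implicit Defensive.
Variable R : realType.
Local Notation C := (R[i]).

Lemma density_exists n : (0 < n)%N -> exists A : 'M[C]_n, density A.
Proof.
case: n => // n _; exists (delta_mx ord0 ord0); split.
  have := psd_gram (delta_mx ord0 ord0 : 'M[C]_n.+1).
  by rewrite adj_delta mul_delta_mx.
rewrite /mxtrace (bigD1 ord0) //= big1 ?addr0 => [|i /negPf ni].
  by rewrite mxE !eqxx.
by rewrite mxE ni.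
Qed.

Lemma ptrace2_tens a b (A : 'M[C]_a) (B : 'M[C]_b) : ptrace2 (A *t B) = \tr B *: A.
Proof.
apply/matrixP => i j; rewrite !mxE mulr_suml; apply: eq_bigr => e _.
by rewrite tensmxE mulrC.
Qed.

Lemma mxtrace_tens a b (A : 'M[C]_a) (B : 'M[C]_b) : \tr (A *t B) = \tr A * \tr B.
Proof. by rewrite -trace_ptrace2 ptrace2_tens mxtraceZ mulrC. Qed.

Lemma psd_tens a b (A : 'M[C]_a) (B : 'M[C]_b) : psd A -> psd B -> psd (A *t B).
Proof.
move=> /psd_factor[D hD <-] /psd_factor[E hE <-].
by rewrite -tensmx_mul -{1}hD -{1}hE -adj_tens; exact: psd_gram.
Qed.

Lemma centre_scalar a (N : 'M[C]_a) (i0 : 'I_a) :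
  (forall A, A *m N = N *m A) -> N = (N i0 i0)%:M.
Proof.
move=> NA.
have L (M : 'M[C]_a) i j k l : (delta_mx i j *m M) k l = (k == i)%:R * M j l.
  rewrite mxE (bigD1 j) //= big1 ?addr0 => [|s /negPf ns]; rewrite mxE ?eqxx ?andbT //.
  by rewrite ns andbF mul0r.
have Rr (M : 'M[C]_a) i j k l : (M *m delta_mx i j) k l = M k i * (l == j)%:R.
  rewrite mxE (bigD1 i) //= big1 ?addr0 => [|s /negPf ns]; rewrite mxE ?eqxx //.
  by rewrite ns mulr0.
apply/matrixP => j l; rewrite [RHS]mxE.
have := congr1 (fun M : 'M_a => M i0 l) (NA (delta_mx i0 j)).
rewrite L Rr eqxx mul1r => ->.
by rewrite eq_sym; case: eqP; rewrite ?mulr1 ?mulr0 ?mulr1n ?mulr0n.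
Qed.

(** The left kernel of h is invariant under all matrices, so one nonzero vector in it forces every
    row of h to vanish. *)
Lemma intertwiner_unit a (h : 'M[C]_a) :
  (forall A, exists B, A *m h = h *m B) -> h != 0 -> h \in unitmx.
Proof.
move=> hAB h0; rewrite -row_free_unit -kermx_eq0; apply: contraR h0.
case/rowV0Pn => v /sub_kermxP vh v0.
have [i vi] : exists i, v 0 i != 0.
  apply/existsP; rewrite -negb_forall; apply: contra v0 => /forallP v00.
  by apply/eqP/rowP => j; rewrite mxE; apply/eqP.
apply/eqP/matrixP => j l; rewrite mxE.
have [B e] := hAB (delta_mx i j).
have : v *m (delta_mx i j *m h) = 0 by rewrite e mulmxA vh mul0mx.
move/matrixP/(_ 0 l); rewrite mulmxA !mxE (bigD1 j) //= big1 ?addr0 => [|s /negPf ns].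
  rewrite mxE (bigD1 i) //= big1 ?addr0 => [|s /negPf ns].
    by rewrite mxE !eqxx mulr1 => /eqP; rewrite mulf_eq0 (negPf vi) => /eqP.
  by rewrite mxE ns mulr0.
by rewrite mxE big1 ?mul0r // => t _; rewrite mxE ns andbF mulr0.
Qed.

(* Each G-slice of M intertwines A and B, as does their sum h = Tr_G M, which is
   therefore invertible; so slice * h^-1 is central, hence scalar. *)
Lemma tensor_factor a g (M : 'M[C]_(a * g)) : psd M -> M != 0 ->
  (forall A, exists B, (A *t 1%:M) *m M = M *m (B *t 1%:M)) ->
  exists2 tau : 'M[C]_g, density tau & M = ptrace2 M *t tau.
Proof.
move=> pM M0 hM; pose sl (x y : 'I_g) := adj (insr R a x) *m M *m insr R a y.
set h := ptrace2 M.
have slAB A B x y : (A *t 1%:M) *m M = M *m (B *t 1%:M) -> A *m sl x y = sl x y *m B.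
  move=> e; rewrite /sl -[RHS]mulmxA -tens1_insr !mulmxA -(mulmxA _ M) -e mulmxA.
  congr (_ *m _ *m _); have := congr1 (@adj R _ _) (tens1_insr (adj A) x).
  by rewrite !adjM adj_tens1 !adjK.
have hAB A B : (A *t 1%:M) *m M = M *m (B *t 1%:M) -> A *m h = h *m B.
  by move=> e; rewrite -ptrace2_mull e ptrace2_mulr.
have tM : 0 < \tr M.
  rewrite lt_neqAle psd_trace // andbT eq_sym.
  by apply: contra M0 => /eqP/psd_trace_eq0 ->.
have h0 : h != 0.
  by apply/eqP => e; move: tM; rewrite -trace_ptrace2 -/h e mxtrace0 ltxx.
have hu : h \in unitmx.
  by apply: intertwiner_unit => // A; have [B /hAB e] := hM A; exists B.
have slh x y : sl x y = (\tr (sl x y) / \tr h) *: h.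
  suff [c ->] : exists c, sl x y = c *: h.
    by rewrite mxtraceZ mulfK // trace_ptrace2 gt_eqF.
  have a_gt0 : (0 < a)%N.
    rewrite lt0n; apply: contra h0 => /eqP a0; apply/eqP/matrixP => -[k lk].
    by exfalso; move: lk; rewrite a0.
  pose i0 := Ordinal a_gt0.
  exists ((sl x y *m invmx h) i0 i0); rewrite -mul_scalar_mx -centre_scalar.
    by rewrite mulmxKV.
  move=> A; have [B e] := hM A; rewrite mulmxA (slAB _ _ _ _ e).
  rewrite -(mulmxA (sl x y) B) -(mulmxA (sl x y) _ A).
  congr (_ *m _); rewrite -[LHS](mulKmx hu); congr (_ *m _).
  by rewrite mulmxA -(hAB _ _ e) mulmxK.
exists (\matrix_(x, y) (\tr (sl x y) / \tr h)); last first.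
  apply/matrixP => r s; case: (mxtens_indexP r) => i x; case: (mxtens_indexP s) => j y.
  rewrite tensmxE [X in _ = _ * X]mxE mulrC.
  have := congr1 (fun N : 'M_a => N i j) (slh x y).
  by rewrite [X in _ = X -> _]mxE => <-; rewrite mulmx_insr adj_insr_mulmx.
(* This tau is the partial trace of M over its first factor divided by tr M, which makes positivity
   and normalization visible. *)
have -> : (\matrix_(x, y) (\tr (sl x y) / \tr h))
    = (\tr M)^-1 *: \sum_(i < a) adj (insl R g i) *m M *m insl R g i.
  apply/matrixP => x y; rewrite !mxE trace_ptrace2 mulrC summxE; congr (_ * _).
  apply: eq_bigr => i _; rewrite mulmx_insl adj_insl_mulmx.
  by rewrite mulmx_insr adj_insr_mulmx.
split.
  apply: psdZ; first by rewrite invr_ge0 ltW.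
  by apply: psd_sum => i _; exact: psd_conj.
rewrite mxtraceZ linear_sum /= -[X in _ * X = _](_ : \tr M = _).
  by rewrite mulVf // gt_eqF.
rewrite -[in LHS](mulmx1 M) -sum_insl mulmx_sumr linear_sum /=.
by apply: eq_bigr => i _; rewrite mulmxA mxtrace_mulC mulmxA.
Qed.
End TensorFactor.

(** * Gluing block factorizations into a Markov decomposition *)

Section MarkovAssembly.
Set Implicit Arguments.
Unset Strict Implicit.
Unset Printing Implicit Defensive.
Variable R : realType.
Local Notation C := (R[i]).

(** Regroups (L R) E as L (R E): the two dimension products are only propositionally equal, hence
    the cast. *)
Definition reassoc a b g (M : 'M[C]_(a * b * g)) : 'M[C]_(a * (b * g)) :=
  castmx (esym (mulnA a b g), esym (mulnA a b g)) M.

Lemma mxtens_index_assoc a b g (x : 'I_a) (y : 'I_b) (e : 'I_g)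
    (eq : (a * (b * g))%N = (a * b * g)%N) :
  cast_ord eq (mxtens_index (x, mxtens_index (y, e)))
    = mxtens_index (mxtens_index (x, y), e).
Proof. by apply: val_inj => /=; rewrite mulnDl mulnA addnA. Qed.

Lemma reassocE a b g (M : 'M[C]_(a * b * g)) x y e x' y' e' :
  reassoc M (mxtens_index (x, mxtens_index (y, e)))
            (mxtens_index (x', mxtens_index (y', e')))
    = M (mxtens_index (mxtens_index (x, y), e))
        (mxtens_index (mxtens_index (x', y'), e')).
Proof. by rewrite /reassoc castmxE !mxtens_index_assoc. Qed.

Lemma reassocM a b g (M N : 'M[C]_(a * b * g)) :
  reassoc (M *m N) = reassoc M *m reassoc N.
Proof. by rewrite /reassoc; case: _ / (esym _). Qed.

Lemma reassoc_psd a b g (M : 'M[C]_(a * b * g)) : psd M -> psd (reassoc M).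
Proof. by rewrite /reassoc; case: _ / (esym _). Qed.

Lemma reassoc_trace a b g (M : 'M[C]_(a * b * g)) : \tr (reassoc M) = \tr M.
Proof. by rewrite /reassoc; case: _ / (esym _). Qed.

Lemma reassoc_tens1 a b g (A : 'M[C]_a) :
  reassoc ((A *t (1%:M : 'M_b)) *t (1%:M : 'M_g)) = A *t 1%:M.
Proof.
apply/matrixP => r s.
case: (mxtens_indexP r) => x k; case: (mxtens_indexP k) => y e.
case: (mxtens_indexP s) => x' k'; case: (mxtens_indexP k') => y' e'.
by rewrite reassocE !tensmxE -mulrA -tensmxE tens11.
Qed.

Lemma markov_blockE dR a b dE (sL : 'M[C]_(dR * a)) (sR : 'M[C]_(b * dE))
    r x y e r' x' y' e' :
  markov_block sL sR (mxtens_index (r, mxtens_index (mxtens_index (x, y), e)))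
                     (mxtens_index (r', mxtens_index (mxtens_index (x', y'), e')))
  = sL (mxtens_index (r, x)) (mxtens_index (r', x')) *
    sR (mxtens_index (y, e)) (mxtens_index (y', e')).
Proof. by rewrite mxE; do 3 (cbn [fst snd]; rewrite ?mxtens_indexK). Qed.

(** As tau_k is common to all l, the label l and the factor L merge into one state, the mixture of
    |l><l| (x) s_{l,k} normalized by its weight lam_k. *)
Lemma markov_of_blocks m dS dE (rho : 'I_m -> 'M[C]_(dS * dE))
    K (B : 'I_K -> block R dS)
    (tau : forall k, 'M[C]_(blockR (B k) * dE)) :
  (0 < m)%N -> (forall l, density (rho l)) ->
  (forall k, (0 < blockL (B k))%N) ->
  (forall k, adj (blockW (B k)) *m blockW (B k) = 1%:M) ->
  orthogonal_blocks B ->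
  \sum_k blockW (B k) *m adj (blockW (B k)) = 1%:M ->
  (forall k, density (tau k)) ->
  (forall l i j, i != j ->
     adj (blockW (B i) *t 1%:M) *m rho l *m (blockW (B j) *t 1%:M) = 0) ->
  (forall l k, exists2 s, psd s &
     reassoc (adj (blockW (B k) *t 1%:M) *m rho l *m (blockW (B k) *t 1%:M))
       = s *t tau k) ->
  markov_state (omega_ref rho).
Proof.
move=> m0 drho a0 WW oW sW dtau off diag.
pose T k := blockW (B k) *t (1%:M : 'M[C]_dE).
pose N l k := adj (T k) *m rho l *m T k.
pose s l k := ptrace2 (reassoc (N l k)).
have Ns l k : reassoc (N l k) = s l k *t tau k.
  have [s' _ e] := diag l k; rewrite /s /N /T e ptrace2_tens.
  by have [_ ->] := dtau k; rewrite scale1r.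
have ps l k : psd (s l k).
  by apply/ptrace2_psd/reassoc_psd/psd_conj; have [] := drho l.
have ts l k : \tr (s l k) = \tr (N l k) by rewrite trace_ptrace2 reassoc_trace.
have sT : \sum_k T k *m adj (T k) = 1%:M.
  rewrite -(tens11 R dS dE) -sW (lin_sum (@tens1_linear R dS dE)).
  by apply: eq_bigr => k _; rewrite adj_tens1 -tens1_mul.
have rhoE l : rho l = \sum_k T k *m N l k *m adj (T k).
  rewrite -[LHS]mul1mx -[LHS]mulmx1 -sT mulmx_sumr; apply: eq_bigr => k _.
  rewrite !mulmx_suml (bigD1 k) //= big1 ?addr0 => [|j jk].
    by rewrite /N !mulmxA.
  have -> : T j *m adj (T j) *m rho l *m (T k *m adj (T k))
      = T j *m (adj (T j) *m rho l *m T k) *m adj (T k) by rewrite !mulmxA.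
  by rewrite off // mulmx0 mul0mx.
have m1 : (0 : C) <= m%:R^-1 by rewrite invr_ge0 ler0n.
pose lam k : C := \sum_l m%:R^-1 * \tr (s l k).
have lam0 k : 0 <= lam k.
  by apply: sumr_ge0 => l _; rewrite mulr_ge0 // psd_trace.
have ma0 k : (0 < m * blockL (B k))%N by rewrite muln_gt0 m0 a0.
(* A block of weight zero still needs some density operator as its left state; there every s_{l,k}
   vanishes, so the choice does not affect the sum. *)
pose dflt k := projT1 (cid (density_exists R (ma0 k))).
have hd k : density (dflt k) by exact: projT2 (cid _).
pose sL k := if lam k == 0 then dflt k else
  (lam k)^-1 *: \sum_l m%:R^-1 *: (delta_mx l l *t s l k).
have tdelta (l : 'I_m) : \tr (delta_mx l l : 'M[C]_m) = 1.
  rewrite /mxtrace (bigD1 l) //= big1 ?addr0 => [|i /negPf ni].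
    by rewrite mxE !eqxx.
  by rewrite mxE ni.
exists K, (fun k => blockL (B k)), (fun k => blockR (B k)), (fun k => blockW (B k)),
  lam, sL, tau; split=> //.
- split=> //; rewrite exchange_big /=.
  transitivity (\sum_(l < m) (m%:R^-1 : C)); last first.
    by rewrite sumr_const card_ord -[LHS]mulr_natl mulfV // pnatr_eq0 -lt0n.
  apply: eq_bigr => l _; rewrite -mulr_sumr; have [_ t1] := drho l.
  suff <- : \tr (rho l) = \sum_k \tr (s l k) by rewrite t1 mulr1.
  rewrite rhoE linear_sum /=; apply: eq_bigr => k _.
  rewrite ts mxtrace_mulC mulmxA [X in X *m _](_ : _ = 1%:M) ?mul1mx //.
  by rewrite adj_tens1 -tens1_mul WW tens11.
- move=> k; split=> //; rewrite /sL; case: eqP => // /eqP lk; split.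
    apply: psdZ; first by rewrite invr_ge0.
    apply: psd_sum => l _; apply/psdZ/psd_tens => //.
    have := psd_gram (delta_mx l l : 'M[C]_m).
    by rewrite adj_delta mul_delta_mx.
  rewrite mxtraceZ linear_sum /= -[X in _ * X = _](_ : lam k = _) ?mulVf //.
  by apply: eq_bigr => l _; rewrite mxtraceZ mxtrace_tens tdelta mul1r.
have key k : lam k *: markov_block (sL k) (tau k)
    = \sum_l m%:R^-1 *: (delta_mx l l *t N l k).
  have -> : lam k *: markov_block (sL k) (tau k)
      = markov_block (\sum_l m%:R^-1 *: (delta_mx l l *t s l k)) (tau k).
    apply/matrixP => r t; rewrite !mxE mulrA; congr (_ * _).
    rewrite /sL; case: eqP => [l0|/eqP l0]; last by rewrite mxE mulrA divff ?mul1r.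
    rewrite l0 mul0r summxE big1 // => l _.
    have : m%:R^-1 * \tr (s l k) == 0.
      move/eqP: l0; rewrite psumr_eq0 => [/allP/(_ l (mem_index_enum l))//|j _].
      by rewrite mulr_ge0 // psd_trace.
    rewrite mulf_eq0 invr_eq0 pnatr_eq0 -leqn0 leqNgt m0 /= => /eqP/psd_trace_eq0 ->//.
    by rewrite tensmx0 scaler0 mxE.
  apply/matrixP => r t.
  case: (mxtens_indexP r) => l xe; case: (mxtens_indexP xe) => xy e.
  case: (mxtens_indexP xy) => x y.
  case: (mxtens_indexP t) => l' xe'; case: (mxtens_indexP xe') => xy' e'.
  case: (mxtens_indexP xy') => x' y'.
  rewrite markov_blockE !summxE mulr_suml; apply: eq_bigr => j _.
  rewrite mxE [RHS]mxE !tensmxE -!mulrA; congr (_ * (_ * _)).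
  by rewrite -reassocE Ns tensmxE.
rewrite /omega_ref.
under eq_bigr => l _ do rewrite rhoE.
have tens_sum l : delta_mx l l *t (\sum_k T k *m N l k *m adj (T k))
    = \sum_k delta_mx l l *t (T k *m N l k *m adj (T k)).
  apply/matrixP => i j; rewrite mxE !summxE mulr_sumr.
  by apply: eq_bigr => k _; rewrite [RHS]mxE.
under eq_bigr => l _ do rewrite tens_sum scaler_sumr.
rewrite exchange_big /=; apply: eq_bigr => k _.
rewrite [RHS]scalemxAl [X in _ = X *m _]scalemxAr key mulmx_sumr mulmx_suml; apply: eq_bigr => l _.
rewrite -scalemxAr -scalemxAl -/(T k); congr (_ *: _).
by rewrite adj_tens adj1 !tensmx_mul mul1mx mulmx1.
Qed.
End MarkovAssembly.

(** * Markov structure from an algebra that passes through the root of the average state *)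

Section ModularMarkov.
Set Implicit Arguments.
Unset Strict Implicit.
Unset Printing Implicit Defensive.
Variable R : realType.
Local Notation C := (R[i]).
Variables (dS dE m : nat) (F : 'M[C]_dS -> Prop) (Q : 'M[C]_(dS * dE)).
Local Notation t1 X := (X *t (1%:M : 'M[C]_dE)).
Hypotheses (sF : star_algebra F) (F1 : F 1%:M) (pQ : psd Q).
Hypothesis FQ : forall X, F X -> exists2 X', F X' & t1 X *m Q = Q *m t1 X'.

Let hQ : adj Q = Q. Proof. exact: psd_herm. Qed.

Let FQl X : F X -> exists2 X', F X' & Q *m t1 X = t1 X' *m Q.
Proof.
have [_ _ _ FA] := sF => FX; have [X' FX' e] := FQ (FA _ FX).
exists (adj X'); first exact: FA.
have := congr1 (@adj R _ _) e; rewrite !adjM hQ !adj_tens1 adjK => ->.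
by [].
Qed.

(* With t1 z' *m Q *m t1 z = adj M *m Q for some M in F that z annihilates,
   adj M *m Q *m M vanishes, hence so does Q *m M. *)
Lemma central_proj_comm z : F z -> adj z = z -> z *m z = z ->
  (forall X, F X -> X *m z = z *m X) -> t1 z *m Q = Q *m t1 z.
Proof.
move=> Fz hz zz zC; have [N FN e] := FQ Fz.
pose z' := 1%:M - z.
have hz' : adj z' = z' by rewrite /z' adjB adj1 hz.
have zz' : z *m z' = 0 by rewrite mulmxBr mulmx1 zz subrr.
have eM : t1 z *m Q *m t1 z' = Q *m t1 (N *m z').
  by rewrite e -mulmxA -tens1_mul.
have zM : z *m (N *m z') = 0 by rewrite mulmxA -zC // -mulmxA zz' mulmx0.
have eM' : t1 z' *m Q *m t1 z = adj (t1 (N *m z')) *m Q.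
  rewrite -hQ -adjM hQ -eM !adjM hQ !adj_tens1 hz hz' mulmxA.
  by [].
have QM : Q *m t1 (N *m z') = 0.
  apply: psd_trace_sandwich_eq0 => //.
  by rewrite -eM' -(mulmxA _ (t1 z)) -tens1_mul zM tens0mx mulmx0 mxtrace0.
have zQz : t1 z *m Q = t1 z *m Q *m t1 z.
  apply/eqP; rewrite -subr_eq0 -{1}[t1 z *m Q]mulmx1 -(tens11 R dS dE) -mulmxBr.
  by rewrite -(linB (@tens1_linear R dS dE)) eM QM.
rewrite zQz; have := congr1 (@adj R _ _) zQz.
by rewrite !adjM hQ adj_tens1 hz mulmxA => <-.
Qed.

Variables (sigma : 'M[C]_(dS * dE)) (rho : 'I_m -> 'M[C]_(dS * dE)).
Hypotheses (QQ : Q *m Q = sigma) (m_gt0 : (0 < m)%N).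
Hypothesis drho : forall l, density (rho l).
Hypothesis rhoF : forall l, exists2 X, F X & rho l = Q *m t1 X *m Q.

(** Block projections commute with Q, so sigma is block diagonal, and its blocks factor by
    [tensor_factor]. In rho_l = (Y (x) 1) sigma the element Y acts only on the left factors, so
    tau_k is inherited from sigma. *)
Lemma modular_markov : markov_state (omega_ref rho).
Proof.
have dE_gt0 : (0 < dE)%N.
  have [_ tr1] := drho (Ordinal m_gt0); rewrite lt0n; apply/eqP => dE0.
  move: tr1; rewrite -trace_ptrace2 ptrace2E big1 ?mxtrace0 => [/esym/eqP|e _].
    by rewrite oner_eq0.
  by have := ltn_ord e; rewrite {2}dE0.
have [K [B [bB oB sB]]] := star_algebra_blocks sF F1 (fun X _ => mul1mx X).
pose T k := t1 (blockW (B k)).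
have WW k : adj (blockW (B k)) *m blockW (B k) = 1%:M by case: (bB k).
have [z zE] : exists z, forall k, z k = blockW (B k) *m adj (blockW (B k)).
  by exists (fun k => blockW (B k) *m adj (blockW (B k))).
have zs k : t1 (z k) *m sigma = sigma *m t1 (z k).
  have [Fz hz zz _ /(_ sF) zC] := block_proj (bB k).
  have c : t1 (z k) *m Q = Q *m t1 (z k) by rewrite zE; exact: central_proj_comm.
  by rewrite -QQ mulmxA c -[LHS]mulmxA c mulmxA.
have Wz k : adj (blockW (B k)) *m z k = adj (blockW (B k)).
  by rewrite zE mulmxA WW mul1mx.
have soff i j : i != j -> adj (T i) *m sigma *m T j = 0.
  move=> ij; rewrite /T adj_tens1 -[adj _]Wz tens1_mul -(mulmxA _ (t1 (z i))) zs.
  by rewrite -!mulmxA -tens1_mul zE -mulmxA oB // mulmx0 tens0mx !mulmx0.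
have rhoY l : exists2 Y, F Y & rho l = t1 Y *m sigma.
  have [X FX e] := rhoF l; have [Y FY eY] := FQl FX.
  by exists Y => //; rewrite e eY -mulmxA QQ.
have TY k Y : F Y -> exists A, adj (T k) *m t1 Y = t1 (A *t 1%:M) *m adj (T k).
  have [_ _ _ FA] := sF; have [_ _ WX _] := bB k => FY.
  have [A XW] := WX _ (FA _ FY); exists (adj A).
  rewrite /T adj_tens1 -!tens1_mul; congr (t1 _).
  have := congr1 (@adj R _ _) XW; rewrite !adjM adjK adj_tens adj1 => ->.
  by [].
pose M k := reassoc (adj (T k) *m sigma *m T k).
have psig : psd sigma by rewrite -QQ -{1}hQ; exact: psd_gram.
have pM k : psd (M k) by apply/reassoc_psd/psd_conj.
have MAB k A : exists A', (A *t 1%:M) *m M k = M k *m (A' *t 1%:M).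
  have [_ _ WX FW] := bB k.
  (* Two passes, one for each factor Q of sigma. *)
  have [X1 FX1 e1] := FQ (FW A); have [X2 FX2 e2] := FQ FX1.
  have [A' eA'] := WX _ FX2; exists A'.
  rewrite -!(reassoc_tens1 _ dE) -!reassocM; congr (reassoc _).
  have -> : t1 (A *t 1%:M) *m (adj (T k) *m sigma *m T k)
     = adj (T k) *m (t1 (blockW (B k) *m (A *t 1%:M) *m adj (blockW (B k))) *m sigma) *m T k.
    rewrite !mulmxA; congr (_ *m _ *m _).
    by rewrite /T adj_tens1 -!tens1_mul !mulmxA WW mul1mx.
  have -> : t1 (blockW (B k) *m (A *t 1%:M) *m adj (blockW (B k))) *m sigma
      = sigma *m t1 X2 by rewrite -QQ mulmxA e1 -[LHS]mulmxA e2 mulmxA.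
  rewrite !mulmxA -(mulmxA _ _ (T k)).
  by rewrite /T -tens1_mul eA' tens1_mul !mulmxA.
have [dfl ddfl] : exists dfl : forall k, 'M[C]_(blockR (B k) * dE),
    forall k, density (dfl k).
  have h k : (0 < blockR (B k) * dE)%N.
    by rewrite muln_gt0 dE_gt0 andbT; case: (bB k) => -[].
  by exists (fun k => projT1 (cid (density_exists R (h k)))) => k; exact: projT2 (cid _).
have tauP k : exists t : 'M[C]_(blockR (B k) * dE),
    density t /\ M k = ptrace2 (M k) *t t.
  have [M0|M0] := eqVneq (M k) 0.
    by exists (dfl k); split=> //; rewrite M0 (lin0 (@ptrace2_linear R _ _)) tens0mx.
  by have [t dt e] := tensor_factor (pM k) M0 (MAB k); exists t.
pose tau k := projT1 (cid (tauP k)).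
have [dtau Mtau] : (forall k, density (tau k)) /\
    forall k, M k = ptrace2 (M k) *t tau k.
  by split=> k; have [] := projT2 (cid (tauP k)).
apply: (markov_of_blocks (B := B) (tau := tau)) => //.
- by move=> k; case: (bB k) => -[].
- move=> l i j ij; have [Y FY ->] := rhoY l; have [A e] := TY i Y FY.
  rewrite -/(T i) -/(T j) mulmxA e -!mulmxA (mulmxA (adj (T i))) soff //.
  by rewrite mulmx0.
- move=> l k; rewrite -/(T k).
  have [Y FY eY] := rhoY l; have [A e] := TY k Y FY.
  have eN : reassoc (adj (T k) *m rho l *m T k) = (A *m ptrace2 (M k)) *t tau k.
    rewrite eY mulmxA e -!mulmxA (mulmxA (adj (T k))) reassocM reassoc_tens1.
    by rewrite -/(M k) Mtau tensmx_mul mul1mx -Mtau.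
  exists (A *m ptrace2 (M k)) => //.
  have [_ tt] := dtau k; rewrite -[_ *m _]scale1r -tt -ptrace2_tens -eN.
  by apply/ptrace2_psd/reassoc_psd/psd_conj; case: (drho l).
Qed.
End ModularMarkov.

(** * Spans, the recovery channel and the conclusion *)

Lemma span_image_sum (K : fieldType) (V : vectType K) (I : finType) (f : I -> V)
    (X : V) :
  X \in <<[seq f l | l : I]>>%VS -> exists c, X = \sum_l c l *: f l.
Proof.
rewrite /image_mem; elim: (enum _) X => [|a s IH] X /=.
  rewrite span_nil memv0 => /eqP ->; exists (fun=> 0).
  by rewrite big1 // => i _; rewrite scale0r.
rewrite span_cons => /memv_addP[_ /vlineP[k ->] [Y /IH[c ->] ->]].
exists (fun i => c i + (i == a)%:R * k).
rewrite [RHS](eq_bigr (fun i => c i *: f i + ((i == a)%:R * k) *: f i)) => [|i _].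
  rewrite big_split /= addrC; congr (_ + _).
  rewrite (bigD1 a) //= eqxx mul1r big1 ?addr0 // => i /negPf ->.
  by rewrite mul0r scale0r.
by rewrite scalerDl.
Qed.

Lemma mem_span_image (K : fieldType) (V : vectType K) (I : finType) (f : I -> V) c :
  \sum_l c l *: f l \in <<[seq f l | l : I]>>%VS.
Proof.
by apply: rpred_sum => l _; apply/rpredZ/memv_span/imageP; exists l.
Qed.

Section PetzMap.
Set Implicit Arguments.
Unset Strict Implicit.
Unset Printing Implicit Defensive.
Variable R : realType.
Local Notation C := (R[i]).
Variables (n d : nat) (sigma Q G : 'M[C]_(n * d)) (q g : 'M[C]_n).
Hypotheses (sQG : sqrt_pinv sigma Q G) (sqg : sqrt_pinv (ptrace2 sigma) q g).
Hypothesis tr_sigma : \tr sigma = 1.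

(* The second summand only makes the map trace preserving off the support of
   ptrace2 sigma. *)
Definition petz_map (Y : 'M[C]_n) : 'M[C]_(n * d) :=
  Q *m ((g *m Y *m g) *t 1%:M) *m Q + \tr ((1%:M - q *m g) *m Y) *: sigma.

Let hQ : adj Q = Q. Proof. by case: sQG => -[/psd_herm]. Qed.
Let hg : adj g = g. Proof. by case: sqg => -[_ /psd_herm]. Qed.

Lemma petz_map_linear : linear petz_map.
Proof.
move=> c X Y; rewrite /petz_map mulmxDr -scalemxAr mulmxDl -scalemxAl tens1_linear.
rewrite mulmxDr -scalemxAr mulmxDl -scalemxAl mulmxDr -scalemxAr linearP /=.
by rewrite scalerDl scalerDr scalerA addrACA.
Qed.

Lemma petz_map_tp : trace_preserving petz_map.
Proof.
move=> Y; rewrite mxtraceD mxtraceZ tr_sigma mulr1.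
have [_ QQ _ _ _] := sQG.
rewrite mxtrace_mulC mulmxA QQ mxtrace_mulC ptrace2_dual mxtrace_mulC.
have -> : \tr (ptrace2 sigma *m (g *m Y *m g)) = \tr (q *m g *m Y).
  by rewrite mulmxA mxtrace_mulC !mulmxA (sqrt_pinv_whiten sqg).
by rewrite -mxtraceD -mulmxDl addrC subrK mul1mx.
Qed.

Lemma petz_map_cp : completely_positive petz_map.
Proof.
have [hp pp] := sqrt_pinv_proj sqg; apply: cp_add.
  apply: (@cp_ext _ _ _ (fun Y => Q *m ((g *m Y *m adj g) *t 1%:M) *m adj Q)).
    by move=> Y; rewrite hg hQ.
  by apply: cp_comp (cp_conj Q) _; apply: cp_comp (@cp_tens1 R n d) (cp_conj g).
apply: cp_trace_prepare.
- by rewrite adjB adj1 hp.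
- by rewrite mulmxBr mulmx1 mulmxBl mul1mx pp subrr subr0.
- by have [_ <- _ _ _] := sQG; rewrite -{1}hQ; exact: psd_gram.
Qed.

Lemma petz_map_pos : positive_map petz_map.
Proof.
move=> Y pY; have [hp pp] := sqrt_pinv_proj sqg; apply: psdD.
  by apply: psd_conj_herm => //; apply/tens1_psd/psd_conj_herm.
apply: psdZ; last by have [_ <- _ _ _] := sQG; rewrite -{1}hQ; exact: psd_gram.
by apply: psd_trace_mul => //; exact: psd_compl_proj.
Qed.
End PetzMap.

Theorem theorem3p1 (R : realType) (dS dE m : nat)
  (S : 'M[R[i]]_(dS * dE) -> Prop)
  (rho : 'I_m -> 'M[R[i]]_(dS * dE)) :
  (* S is a nonempty set of density operators on H_S (x) H_E *)
  (forall X, S X -> density X) ->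
  (exists X, S X) ->
  (* S' = {rho^(1), ..., rho^(m)} is a maximal linearly independent subset of S *)
  (forall l, S (rho l)) ->
  free [seq rho l | l : 'I_m] ->
  (forall X, S X -> ~~ free (X :: [seq rho l | l : 'I_m])) ->
  (* the reduced states are linearly independent *)
  free [seq ptrace2 (rho l) | l : 'I_m] ->
  (* a linear trace-preserving positive map Lambda^(P) with
     Lambda^(P)(rho_S^(l)) = rho_SE^(l) *)
  (exists LamP : 'M[R[i]]_dS -> 'M[R[i]]_(dS * dE),
     [/\ linear LamP, trace_preserving LamP, positive_map LamP &
         forall l, LamP (ptrace2 (rho l)) = rho l]) ->
  (* (i) *)
  markov_state (omega_ref rho) /\
  (* (ii) and (iii) *)
  exists LamCP : 'M[R[i]]_dS -> 'M[R[i]]_(dS * dE),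
    [/\ linear LamCP, trace_preserving LamCP, completely_positive LamCP &
        forall l, LamCP (ptrace2 (rho l)) = rho l] /\
    (* (iii) *)
    (forall Y : 'M[R[i]]_dS,
           (exists X : 'M[R[i]]_(dS * dE),
              [/\ density X, X \in <<[seq rho l | l : 'I_m]>>%VS &
                  ptrace2 X = Y])
           <-> (density Y /\ Y \in <<[seq ptrace2 (rho l) | l : 'I_m]>>%VS)) /\
    (forall U : 'M[R[i]]_(dS * dE), unitary U ->
          completely_positive (fun Y : 'M[R[i]]_dS =>
                                 ptrace2 (U *m LamCP Y *m adj U)) /\
          (forall X : 'M[R[i]]_(dS * dE),
             density X -> X \in <<[seq rho l | l : 'I_m]>>%VS ->
             ptrace2 (U *m LamCP (ptrace2 X) *m adj U)
               = ptrace2 (U *m X *m adj U))).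
Proof.
move=> dS_S [X0 SX0] Srho _ maxS _ [Lam [Lam_lin Lam_tp Lam_pos Lam_rho]].
have drho l : density (rho l) by exact/dS_S/Srho.
have prho l : psd (rho l) by case: (drho l).
(* For m = 0 maximality would make the singleton of X0 dependent, so X0 = 0, against trace one. *)
have m_gt0 : (0 < m)%N.
  rewrite lt0n; apply/eqP => m0; have [_ tr1] := dS_S _ SX0.
  have := maxS _ SX0; have -> : [seq rho l | l : 'I_m] = [::].
    by apply/nilP; rewrite /nilp size_image card_ord m0.
  rewrite seq1_free negbK => /eqP X00; move: tr1; rewrite X00 mxtrace0.
  by move/esym/eqP; rewrite oner_eq0.
have mn0 : m%:R != 0 :> R[i] by rewrite pnatr_eq0 -lt0n.
pose sigma := (m%:R^-1 : R[i]) *: \sum_l rho l.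
have psig : psd sigma by apply: psdZ; [rewrite invr_ge0 ler0n | exact: psd_sum].
have trsig : \tr sigma = 1.
  rewrite mxtraceZ linear_sum /= (eq_bigr (fun=> 1)) => [|l _]; last by case: (drho l).
  by rewrite sumr_const card_ord mulVf.
have Lsig : Lam (ptrace2 sigma) = sigma.
  rewrite (linZ (@ptrace2_linear R dS dE)) (lin_sum (@ptrace2_linear R dS dE)).
  rewrite (linZ Lam_lin) (lin_sum Lam_lin); congr (_ *: _).
  by apply: eq_bigr => l _.
(* m sigma is the sum of all rho_l, and removing one term leaves a positive sum; this is the
   constant c of [petz_recovery]. *)
have dom l : psd (m%:R *: sigma - rho l).
  rewrite scalerA mulfV // scale1r (bigD1 l) //= addrAC subrr add0r.
  exact: psd_sum.
have m0 : 0 <= m%:R :> R[i] by exact: ler0n.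
have [Q [G sQG]] := psd_sqrt psig.
have [q [g sqg]] := psd_sqrt (ptrace2_psd psig).
have rec l := petz_recovery Lam_lin Lam_tp Lam_pos sQG sqg Lsig m0 (prho l)
  (dom l) (Lam_rho l).
split.
  have [[pQ _] QQ _ _ _] := sQG.
  apply: (modular_markov (petz_algebra_star sQG sqg) (petz_algebra1 sQG sqg) pQ
    (petz_algebra_modular sQG sqg) QQ m_gt0 drho) => l.
  by exists (g *m ptrace2 (rho l) *m g); [exact: (petz_algebra_whiten sqg (rec l)) | exact: rec].
(* The correction term vanishes because domination puts the reduced state inside the support of Tr_E
   sigma. *)
have petz_rho l : petz_map sigma Q q g (ptrace2 (rho l)) = rho l.
  have := dominated_supp sqg (ptrace2_psd (prho l)) (c := m%:R).
  rewrite -(linZ (@ptrace2_linear R dS dE)) -(linB (@ptrace2_linear R dS dE)).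
  move=> /(_ (ptrace2_psd (dom l)))[_ supp].
  by rewrite /petz_map mulmxBl mul1mx supp subrr mxtrace0 scale0r addr0 -rec.
have ptr_sum c : ptrace2 (\sum_l c l *: rho l) = \sum_l c l *: ptrace2 (rho l).
  rewrite (lin_sum (@ptrace2_linear R dS dE)); apply: eq_bigr => l _.
  by rewrite (linZ (@ptrace2_linear R dS dE)).
have petz_sum c : petz_map sigma Q q g (\sum_l c l *: ptrace2 (rho l))
    = \sum_l c l *: rho l.
  rewrite (lin_sum (petz_map_linear sigma Q q g)); apply: eq_bigr => l _.
  by rewrite (linZ (petz_map_linear sigma Q q g)) petz_rho.
have cp := petz_map_cp sQG sqg.
exists (petz_map sigma Q q g); split; first split=> //.
- exact: petz_map_linear.
- exact: petz_map_tp sQG sqg trsig.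
split=> [Y|U _].
  split=> [[X [[pX trX] /span_image_sum[c eX] <-]]|[[pY trY] /span_image_sum[c eY]]].
    split; first by split; [exact: ptrace2_psd | rewrite trace_ptrace2].
    by rewrite eX ptr_sum mem_span_image.
  (* The coefficients of Y are complex, so positivity of the lift is not termwise: the lift is the
     image of Y under the positive map [petz_map]. *)
  exists (\sum_l c l *: rho l); split.
  - split; last by rewrite -trace_ptrace2 ptr_sum -eY.
    by rewrite -petz_sum -eY; exact: petz_map_pos sQG sqg _ pY.
  - exact: mem_span_image.
  - by rewrite ptr_sum.
split=> [|X _ /span_image_sum[c ->]]; last by rewrite ptr_sum petz_sum.
by apply: cp_comp (@cp_ptrace2 R dS dE) _; apply: cp_comp (cp_conj U) cp.
Qed.
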